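(* Let $G$ be a unipotent algebraic group over $\mathbb{C}$, let $J$ be a Hopf $2$-cocycle for $G$ with support $H\subset G$, and let $g\in G$. If $H$ is not $g$-invariant (i.e. $gHg^{-1}\neq H$), then the algebra ${}_J\mathcal{O}(Z_g)_J$ contains a Weyl subalgebra.
   Context: For an affine algebraic group $G$ over $\mathbb{C}$, $\mathcal{O}(G)$ is its coordinate Hopf algebra, with Sweedler notation $\Delta(a)=\sum a_1\otimes a_2$ and counit $\varepsilon$. A Hopf $2$-cocycle for $G$ is a linear form $J:\mathcal{O}(G)\otimes\mathcal{O}(G)\to\mathbb{C}$ that has an inverse $J^{-1}$ for the convolution product $(f*h)(a,b)=\sum f(a_1,b_1)h(a_2,b_2)$ and satisfies $\sum J(a_1b_1,c)J(a_2,b_2)=\sum J(a,b_1c_1)J(b_2,c_2)$ and $J(a,1)=\varepsilon(a)=J(1,a)$ for all $a,b,c$. The Hopf algebra ${}_J\mathcal{O}(G)_J$ equals $\mathcal{O}(G)$ as a coalgebra and has multiplication $a\otimes b\mapsto \sum J^{-1}(a_1,b_1)\,a_2b_2\,J(a_3,b_3)$. Put $R^J:=J_{21}^{-1}*J$, where $J_{21}(a,b)=J(b,a)$; a Hopf $2$-cocycle $J$ for a group $H$ is minimal if $R^J$ is non-degenerate on $\mathcal{O}(H)$. The support of $J$ is the closed subgroup $H\subset G$ such that $J$ is (the pullback along the restriction map $\mathcal{O}(G)\to\mathcal{O}(H)$ of) a minimal Hopf $2$-cocycle for $H$. $Z_g=HgH$ is the $(H,H)$-double coset of $g$, $\mathcal{I}(Z_g)\subset\mathcal{O}(G)$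 its vanishing ideal (which is a two-sided ideal of ${}_J\mathcal{O}(G)_J$), and ${}_J\mathcal{O}(Z_g)_J:={}_J\mathcal{O}(G)_J/\mathcal{I}(Z_g)$. The Weyl algebra $\mathscr{W}_n$ is generated by $p_1,\dots,p_n,q_1,\dots,q_n$ with $[p_i,q_j]=\delta_{ij}$, $[p_i,p_j]=[q_i,q_j]=0$. A Weyl subalgebra is a (unital) subalgebra isomorphic to $\mathscr{W}_n$ for some $n\ge1$. *)

(* Defs.v *)
From HB Require Import structures.
From mathcomp Require Import all_boot all_order all_algebra.
From mathcomp Require Import sesquilinear.
From mathcomp Require Import classical_sets reals.
From mathcomp Require Export complex.

Set Implicit Arguments.
Unset Strict Implicit.
Unset Printing Implicit Defensive.

Import GRing.Theory.

Local Open Scope classical_set_scope.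
Local Open Scope ring_scope.

(* An affine algebraic group over an algebraically closed field [F], as a group
   of points together with its coordinate algebra: a finitely generated algebra
   [coord_alg] of functions on the points ([ev x a] is the value a(x)) such that the
   points are exactly the algebra maps [coord_alg -> F], and for which the product
   and the inverse are morphisms.
   [comul a] lists the pairs (a_1, a_2) of one expression of Delta(a) as a sum of
   a_1 (x) a_2.  As coord_alg (x) coord_alg embeds in the functions on pairs of points,
   [ev_comul] determines the tensor Delta(a), so no expression of the form
   \sum_(p <- comul a) f p.1 p.2 with [f] bilinear depends on the list chosen. *)
Record affine_group (F : fieldType) := AffineGroup {
  points :> groupType;
  coord_alg : comAlgType F;
  ev : points -> {lrmorphism coord_alg -> F | *%R};
  ev_sep : forall a b : coord_alg, (forall x, ev x a = ev x b) -> a = b;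
  ev_inj : forall x y : points, ev x =1 ev y -> x = y;
  ev_surj : forall f : {lrmorphism coord_alg -> F | *%R}, exists x, f =1 ev x;
  coord_fingen : exists s : seq coord_alg, forall S : {pred coord_alg},
    GRing.subalg_closed S -> {subset s <= S} -> forall a, a \in S;
  comul : coord_alg -> seq (coord_alg * coord_alg);
  ev_comul : forall a x y,
    ev (x * y)%g a = \sum_(p <- comul a) ev x p.1 * ev y p.2;
  antipode : coord_alg -> coord_alg;
  ev_antipode : forall a x, ev x (antipode a) = ev (x^-1)%g a
}.

Section AffineGroups.
Variable F : fieldType.
Implicit Types G H : affine_group F.

Definition counit G (a : coord_alg G) : F := ev (1%g : G) a.

(* The pairs-to-triples version of [comul]: (id (x) Delta) Delta(a). *)
Definition comul3 G (a : coord_alg G) : seq (coord_alg G * coord_alg G * coord_alg G) :=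
  [seq (p.1, q.1, q.2) | p <- comul a, q <- comul p.2].

(* (rtrans g a)(x) = a(xg). *)
Definition rtrans G (g : G) (a : coord_alg G) : coord_alg G :=
  \sum_(p <- comul a) ev g p.2 *: p.1.

(* Every element is unipotent, i.e. acts locally unipotently by translation on
   the coordinate algebra. *)
Definition unipotent G : Prop :=
  forall (g : G) (a : coord_alg G), exists n : nat,
    iter n (fun b => rtrans g b - b) a = 0.

(* A group homomorphism that is a closed immersion; [restr] is the restriction
   (comorphism) O(G) -> O(H). *)
Record closed_embedding H G := ClosedEmbedding {
  emb :> H -> G;
  embM : {morph emb : x y / (x * y)%g};
  restr : {lrmorphism coord_alg G -> coord_alg H};
  ev_restr : forall h a, ev h (restr a) = ev (emb h) a;
  restr_surj : forall b, exists a, restr a = b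
}.

(* Linear forms on O(G) (x) O(G) are bilinear forms on O(G). *)
Definition convol G (f h : coord_alg G -> coord_alg G -> F) (a b : coord_alg G) : F :=
  \sum_(p <- comul a) \sum_(q <- comul b) f p.1 q.1 * h p.2 q.2.

Definition convol_unit G (a b : coord_alg G) : F := counit a * counit b.

Record hopf_2cocycle G := Hopf2Cocycle {
  cocyc :> {biscalar coord_alg G};
  cocyc_inv : {biscalar coord_alg G};
  convol_cocyc_inv : forall a b, convol cocyc cocyc_inv a b = convol_unit a b;
  convol_inv_cocyc : forall a b, convol cocyc_inv cocyc a b = convol_unit a b;
  cocycP : forall a b c,
    \sum_(p <- comul a) \sum_(q <- comul b) cocyc (p.1 * q.1) c * cocyc p.2 q.2
    = \sum_(q <- comul b) \sum_(r <- comul c)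
        cocyc a (q.1 * r.1) * cocyc q.2 r.2;
  cocyc1r : forall a, cocyc a 1 = counit a;
  cocyc1l : forall a, cocyc 1 a = counit a
}.

(* J_21^-1 is the flip of J^-1. *)
Definition Rform G (J : hopf_2cocycle G) : coord_alg G -> coord_alg G -> F :=
  convol (fun a b => cocyc_inv J b a) J.

Definition nondegenerate_form G (f : coord_alg G -> coord_alg G -> F) : Prop :=
  (forall a, (forall b, f a b = 0) -> a = 0) /\
  (forall b, (forall a, f a b = 0) -> b = 0).

Definition minimal_cocycle G (J : hopf_2cocycle G) : Prop :=
  nondegenerate_form (Rform J).

Definition is_support G (J : hopf_2cocycle G) (H : set G) : Prop :=
  exists (K : affine_group F) (i : closed_embedding K G) (JK : hopf_2cocycle K),
    [/\ range i = H, minimal_cocycle JK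
      & forall a b, J a b = JK (restr i a) (restr i b)].

(* The multiplication of _J O(G)_J. *)
Definition twmul G (J : hopf_2cocycle G) (a b : coord_alg G) : coord_alg G :=
  \sum_(p <- comul3 a) \sum_(q <- comul3 b)
    (cocyc_inv J p.1.1 q.1.1 * J p.2 q.2) *: (p.1.2 * q.1.2).

Definition double_coset G (H : set G) (g : G) : set G :=
  [set z | exists h h' : G, [/\ H h, H h' & z = (h * g * h')%g]].

Definition conjugate_set G (H : set G) (g : G) : set G :=
  [set (g * h * g^-1)%g | h in H].

Definition vanishing_ideal G (Z : set G) : set (coord_alg G) :=
  [set a | forall z, Z z -> ev z a = 0].

(* [pi] exhibits the algebra [B] as the quotient of _J O(G)_J (the space O(G)
   with product [twmul J] and unit 1) by [I]. *)
Definition is_twisted_quotient G (J : hopf_2cocycle G) (I : set (coord_alg G))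
    (B : algType F) (pi : {linear coord_alg G -> B}) : Prop :=
  [/\ forall b, exists a, pi a = b,
      forall a, pi a = 0 <-> I a,
      pi 1 = 1
    & forall a b, pi (twmul J a b) = pi a * pi b].

End AffineGroups.

Section Weyl.
Variable F : fieldType.

Definition weyl_relations n (A : algType F) (p q : 'I_n -> A) : Prop :=
  [/\ forall i j, p i * q j - q j * p i = (i == j)%:R,
      forall i j, p i * p j - p j * p i = 0
    & forall i j, q i * q j - q j * q i = 0].

(* [W] is the algebra presented by generators p_i, q_i and the relations above. *)
Definition is_weyl_algebra n (W : algType F) (p q : 'I_n -> W) : Prop :=
  [/\ weyl_relations p q,
      forall (A : algType F) (p' q' : 'I_n -> A), weyl_relations p' q' ->
        exists f : {lrmorphism W -> A},
          (forall i, f (p i) = p' i) /\ (forall i, f (q i) = q' i)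
    & forall (A : algType F) (f f' : {lrmorphism W -> A}),
        (forall i, f (p i) = f' (p i)) -> (forall i, f (q i) = f' (q i)) ->
        f =1 f'].

Definition contains_weyl_subalgebra (B : algType F) : Prop :=
  exists n : nat, (1 <= n)%N /\
  exists (W : algType F) (p q : 'I_n -> W) (f : {lrmorphism W -> B}),
    is_weyl_algebra p q /\ injective f.

End Weyl.

(* Main.v *)
Require Import Defs.
From HB Require Import structures.
From mathcomp Require Import all_boot all_order all_algebra.
From mathcomp Require Import sesquilinear boolp.
From mathcomp Require Import classical_sets reals.

Set Implicit Arguments.
Unset Strict Implicit.
Unset Printing Implicit Defensive.

Import Order.TTheory GRing.Theory Num.Theory.

Local Open Scope classical_set_scope.
Local Open Scope ring_scope.

(** The idea is to exhibit two elements p and q of the quotient algebra with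
    p q - q p = 1.  In characteristic 0 the ordered monomials q^i p^j of such a
    pair are linearly independent, so their span is a copy of the first Weyl
    algebra (weyl_pair_contains_weyl).

    Let i : K -> G be the closed embedding with image H, JK the minimal cocycle
    on K, and Z = HgH.

    The element p.  As H is not g-invariant, H is not contained in gHg^-1: the
    reverse inclusion alone would give equality, because conjugation by g is a
    locally finite operator preserving the ideal of H
    (conjugate_closed_subgroup).  Hence some function vanishes on gH but not on
    Z, and two applications of Kolchin's fixed vector theorem, for H acting on
    the right and then on the left, turn it into a function P on Z with
    P(hgk) = chi(h), where chi is a nonzero additive character of H
    (character_of_double_coset).

    The commutator with p.  The triple coproduct of P on H x Z x H is
    chi (x) 1 (x) 1 + 1 (x) P (x) 1, so the twisted commutator [P, b] at a point
    z is x(b(. z)), where x(c) = JK^-1(chi, c) - JK^-1(c, chi)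
    (commutator_character).  Since chi is primitive, x = - R(chi, .), and x is
    not zero because R is non-degenerate (Rform_character).

    The element q.  The operator b |-> (z |-> x(b(. z))) is a nonzero operator
    on the functions on the whole of G, where left translation by H commutes
    with right translation by G.  Its image is thus a nonzero submodule for right
    translation, and by Kolchin's theorem it contains a nonzero vector fixed by
    G, that is, the constant 1 (translation_slice).  Any preimage q of 1 satisfies
    [P, q] = 1 on Z.

    The products of the cocycle are sums over chosen expressions of tensors.  They
    are compared through the fact that a multilinear form of a tensor only depends
    on the values of the tensor at tuples of points, which reduces to the trace of
    a zero operator of finite rank being zero (trace_of_zero). *)

(** * Kolchin's fixed vector theorem *)

(** Factor e as C R with C of full column rank and R of full row rank; then
    e e = e says R C = 1, and the trace of C R is that of R C. *)
Lemma mxtrace_idempotent (F : fieldType) n (e : 'M[F]_n) :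
  e *m e = e -> \tr e = (\rank e)%:R.
Proof.
move=> ee; rewrite -{1}(mulmx_base e) mxtrace_mulC.
suff ->: row_base e *m col_base e = 1%:M by rewrite mxtrace1.
apply: (row_full_inj (col_base_full e)); apply: (row_free_inj (row_base_free e)).
by rewrite /= mulmx1 mulmxA mulmx_base -mulmxA mulmx_base ee.
Qed.

Lemma mulmx_horner_eigen (F : fieldType) n (t : 'M[F]_n.+1) (v : 'rV_n.+1) a q :
  v *m t = a *: v -> v *m horner_mx t q = q.[a] *: v.
Proof.
move=> vt; elim/poly_ind: q => [|q c IH].
  by rewrite rmorph0 mulmx0 horner0 scale0r.
rewrite rmorphD rmorphM /= horner_mx_X horner_mx_C hornerMXaddC mulmxDr.
by rewrite -mulmxE mulmxA IH -scalemxAl vt scalerA mul_mx_scalar scalerDl.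
Qed.

(** All eigenvalues vanish, so the characteristic polynomial is a power of 'X. *)
Lemma mxtrace_nilpotent (F : closedFieldType) n (t : 'M[F]_n.+1) m :
  t ^+ m = 0 -> \tr t = 0.
Proof.
move=> tm0; have := char_poly_trace t (ltn0Sn n).
have [s] := closed_field_poly_normal (char_poly t).
rewrite (eqP (char_poly_monic t)) scale1r => ct.
have s0 a : a \in s -> a = 0.
  rewrite -root_prod_XsubC -ct -eigenvalue_root_char.
  case/eigenvalueP=> v vt v0.
  have := mulmx_horner_eigen 'X^m vt.
  rewrite rmorphXn /= horner_mx_X tm0 mulmx0 hornerXn => /esym/eqP.
  rewrite scaler_eq0 (negbTE v0) orbF expf_eq0 => /andP[_ /eqP //].
have cX : char_poly t = 'X^(n.+1).
  have sz := size_char_poly t; rewrite ct size_prod_XsubC in sz.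
  case: sz => sz; rewrite ct (eq_big_seq (fun=> 'X)) ?big_const_seq.
    by rewrite count_predT iter_mulr_1 sz.
  by move=> a /s0 ->; rewrite subr0.
by rewrite cX coefXn /= eqn_leq ltnn andbF => /esym/eqP; rewrite oppr_eq0 => /eqP.
Qed.

(** If t fixes a nonzero vector, a polynomial in t without constant term is an
    idempotent that still fixes it; this idempotent lies in T, and its trace is its
    rank, which is not 0 in characteristic 0. *)
Lemma traceless_no_fixed_vector (F : numFieldType) n (T : 'M[F]_n.+1 -> Prop)
    (T_add : forall a s t, T s -> T t -> T (a *: s + t))
    (T_mul : forall s t, T s -> T t -> T (s *m t))
    (T_tr : forall t, T t -> \tr t = 0)
    (t : 'M[F]_n.+1) (v : 'rV[F]_n.+1) :
  T t -> v *m t = v -> v = 0.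
Proof.
move=> Tt vt; apply/eqP/negP => /negP v0.
have vt1 : v *m t = 1 *: v by rewrite scale1r.
have T0 : T 0 by rewrite -(addNr t) -scaleN1r; apply: T_add.
(* T need not contain 1, so only polynomials without constant term stay in T. *)
have TX q : T (horner_mx t (q * 'X)).
  elim/poly_ind: q => [|q c IH]; first by rewrite mul0r rmorph0.
  rewrite mulrDl rmorphD /= addrC mul_polyC linearZ /= horner_mx_X.
  by apply: T_add => //; rewrite rmorphM /= horner_mx_X; apply: T_mul.
have [m [r r0 ctE]] := multiplicity_XsubC (char_poly t) 0.
rewrite monic_neq0 ?char_poly_monic //= subr0 in r0 ctE.
(* The exponent m.+1 rather than m makes the idempotent e divisible by 'X even
   when 0 is not a root of the characteristic polynomial. *)
have : coprimep ('X^(m.+1)) r.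
  by apply: coprimep_expl; rewrite coprimep_sym -['X]subr0 coprimep_XsubC.
case/Bezout_eq1_coprimepP=> [[u w]] /= uw.
pose e := horner_mx t (u * 'X^(m.+1)).
have ee : e *m e = e.
  apply/eqP; rewrite mulmxE -subr_eq0 -[X in _ - X]mulr1 -mulrBr /e.
  rewrite -(rmorph1 (horner_mx t)) -rmorphB -rmorphM /= -[X in _ - X]uw.
  rewrite opprD addNKr mulrN rmorphN oppr_eq0 exprS.
  have -> : u * ('X * 'X^m) * (w * r) = (u * 'X * w) * (r * 'X^m).
    by rewrite !mulrA -!(mulrAC _ _ 'X^m) -!mulrA [r * _]mulrC.
  by rewrite -ctE rmorphM /= Cayley_Hamilton mulr0.
have rk0 : e = 0.
  apply/eqP; rewrite -mxrank_eq0 -(@pnatr_eq0 F) -(mxtrace_idempotent ee).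
  by apply/eqP/T_tr; rewrite /e exprSr mulrA.
have r1 : r.[1] = 0.
  have := mulmx_horner_eigen (char_poly t) vt1.
  rewrite Cayley_Hamilton mulmx0 ctE hornerM hornerXn expr1n mulr1.
  by move/esym/eqP; rewrite scaler_eq0 (negbTE v0) orbF => /eqP.
have := mulmx_horner_eigen (u * 'X^(m.+1)) vt1.
rewrite -/e rk0 mulmx0 => /esym/eqP; rewrite scaler_eq0 (negbTE v0) orbF.
have := congr1 (fun q => q.[1]) uw.
by rewrite hornerD [(w * r).[1]]hornerM r1 mulr0 addr0 hornerC => -> /eqP/eqP; rewrite oner_eq0.
Qed.

Definition subspace (F : fieldType) (V : lmodType F) (E : V -> Prop) :=
  E 0 /\ forall a u v, E u -> E v -> E (a *: u + v).

Section Subspace.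
Variables (F : fieldType) (V : lmodType F) (E : V -> Prop).
Hypothesis sE : subspace E.

Lemma subspaceD u v : E u -> E v -> E (u + v).
Proof. by move=> Eu Ev; rewrite -[u]scale1r; apply: sE.2. Qed.

Lemma subspaceZ a u : E u -> E (a *: u).
Proof. by move=> Eu; rewrite -[_ *: _]addr0; apply: sE.2 => //; apply: sE.1. Qed.

Lemma subspaceB u v : E u -> E v -> E (u - v).
Proof. by move=> Eu Ev; rewrite addrC -scaleN1r; apply: sE.2. Qed.

Lemma subspace_sum I (r : seq I) (u : I -> V) :
  (forall i, E (u i)) -> E (\sum_(i <- r) u i).
Proof.
move=> Eu; elim: r => [|i r IH]; first by rewrite big_nil; apply: sE.1.
by rewrite big_cons; apply: subspaceD.
Qed.

End Subspace.

Lemma subspace_row (F : fieldType) m n (E : 'rV[F]_n -> Prop) (A : 'M_(m, n)) v :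
  subspace E -> (forall i, E (row i A)) -> (v <= A)%MS -> E v.
Proof.
move=> sE EA /submxP[c ->]; rewrite mulmx_sum_row.
by apply: subspace_sum => // i; apply: subspaceZ.
Qed.

(** Among the nonzero w, one minimizing the dimension of w T works: if w t is
    not 0, then w t T is contained in w T and misses w t, hence is smaller. *)
Lemma nil_algebra_common_kernel (F : fieldType) n (T : 'M[F]_n.+1 -> Prop) :
  subspace T -> (forall s t, T s -> T t -> T (s *m t)) ->
  (forall t v, T t -> v *m t = v -> v = 0 :> 'rV_n.+1) ->
  exists2 w : 'rV_n.+1, w != 0 & forall t, T t -> w *m t = 0.
Proof.
move=> sT T_mul T_nofix.
have sO w : subspace (fun u : 'rV_n.+1 => exists2 t, T t & u = w *m t).
  split=> [|a _ _ [s Ts ->] [t Tt ->]]; first by exists 0; [case: sT | rewrite mulmx0].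
  by exists (a *: s + t); [apply: sT.2 | rewrite mulmxDr scalemxAr].
suff main k (w : 'rV_n.+1) : w != 0 ->
    (forall m (A : 'M_(m, n.+1)),
       (forall i, exists2 t, T t & row i A = w *m t) -> (\rank A <= k)%N) ->
    exists2 w : 'rV_n.+1, w != 0 & forall t, T t -> w *m t = 0.
  apply: (main n.+1 (delta_mx 0 0)) => [|m A _]; last exact: rank_leq_col.
  by apply/eqP => /matrixP/(_ 0 0)/eqP; rewrite !mxE !eqxx oner_eq0.
elim: k w => [|k IH] w w0 bound.
  exists w => // t Tt; apply/eqP; rewrite -mxrank_eq0 -leqn0.
  by apply: bound => i; exists t; rewrite // (row_id i).
case: (pselect (exists2 t, T t & w *m t != 0)) => [[t Tt wt0]|nex]; last first.
  by exists w => // t Tt; apply/eqP/negP => /negP wt0; apply: nex; exists t.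
apply: (IH _ wt0) => m A rA; rewrite -ltnS.
apply: leq_trans (bound _ (col_mx (w *m t) A) _); last first.
  move=> i; rewrite -(splitK i); case: (split i) => j /=.
    by rewrite rowKu (row_id j); exists t.
  rewrite rowKd; have [s Ts ->] := rA j.
  by exists (t *m s); [apply: T_mul | rewrite mulmxA].
rewrite -addsmxE.
apply: rank_ltmx; rewrite ltmxE addsmxSr /=; apply/negP => le.
have [s Ts] := subspace_row (sO (w *m t)) rA (submx_trans (addsmxSl _ _) le).
by move=> /esym/(T_nofix _ _ Ts)/eqP; apply/negP.
Qed.

Definition lincomb (F : fieldType) (V : lmodType F) k (s : 'I_k -> V)
  (c : 'rV[F]_k) : V := \sum_j c 0 j *: s j.

Section Lincomb.
Variables (F : fieldType) (V : lmodType F).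

Lemma lincombP k (s : 'I_k -> V) a c d :
  lincomb s (a *: c + d) = a *: lincomb s c + lincomb s d.
Proof.
rewrite /lincomb scaler_sumr -big_split /=; apply: eq_bigr => j _.
by rewrite !mxE scalerDl scalerA.
Qed.

Lemma lincombB k (s : 'I_k -> V) c d :
  lincomb s (c - d) = lincomb s c - lincomb s d.
Proof. by rewrite [c - d]addrC -[- d]scaleN1r lincombP scaleN1r addrC. Qed.

Lemma lincomb0 k (s : 'I_k -> V) : lincomb s 0 = 0.
Proof. by rewrite -(subrr 0) lincombB subrr. Qed.

Lemma lincomb_delta k (s : 'I_k -> V) i : lincomb s (delta_mx 0 i) = s i.
Proof.
rewrite /lincomb (bigD1 i) //= mxE !eqxx scale1r big1 ?addr0 // => j.
by rewrite mxE => /negbTE ->; rewrite andbF scale0r.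
Qed.

Lemma lincomb_mul k m (s : 'I_k -> V) (c : 'rV_m) (A : 'M_(m, k)) :
  lincomb s (c *m A) = \sum_i c 0 i *: lincomb s (row i A).
Proof.
rewrite /lincomb; under [RHS]eq_bigr do rewrite scaler_sumr.
rewrite exchange_big /=; apply: eq_bigr => j _; rewrite mxE scaler_suml.
by apply: eq_bigr => i _; rewrite scalerA mxE.
Qed.

Lemma dependent_family m k (t : 'I_m -> V) (s : 'I_k -> V) :
  (m < k)%N -> (forall i, exists c, s i = lincomb t c) ->
  exists2 c, c != 0 & lincomb s c = 0.
Proof.
move=> lt /fin_all_exists[f fP]; pose A := \matrix_i f i.
have [j kj] : exists j, row j (kermx A) != 0.
  apply/existsP; rewrite -negb_forall; apply/negP => /forallP k0.
  have: kermx A = 0 by apply/row_matrixP => i; rewrite (eqP (k0 i)) row0.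
  move/eqP; rewrite kermx_eq0 /row_free eqn_leq => /andP[_ le].
  by have := leq_trans le (rank_leq_col A); rewrite leqNgt lt.
exists (row j (kermx A)) => //.
have := lincomb_mul t (row j (kermx A)) A.
rewrite -row_mul mulmx_ker row0 lincomb0 => ->.
by apply: eq_bigr => i _; rewrite fP rowK.
Qed.

(** Families independent modulo N inside the span of t have bounded size, so a
    maximal one exists, and it spans E modulo N. *)
Lemma basis_modulo (E N : V -> Prop) m (t : 'I_m -> V) :
  subspace E -> subspace N -> (forall e, E e -> exists c, e = lincomb t c) ->
  exists k (s : 'I_k -> V),
    [/\ forall i, E (s i), forall c, N (lincomb s c) -> c = 0
      & forall e, E e -> exists c, N (e - lincomb s c)].
Proof.
move=> sE sN Et.
suff main d k (s : 'I_k -> V) : (m < k + d)%N -> (forall i, E (s i)) ->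
    (forall c, N (lincomb s c) -> c = 0) -> exists k (s : 'I_k -> V),
    [/\ forall i, E (s i), forall c, N (lincomb s c) -> c = 0
      & forall e, E e -> exists c, N (e - lincomb s c)].
  apply: (main m.+1 0 (fun=> 0)) => [|[]//|c _]; first by rewrite add0n.
  by apply/rowP => -[].
elim: d k s => [|d IH] k s lt Es indep.
  (* more vectors than m in the span of t are dependent *)
  rewrite addn0 in lt; have sp i : exists c, s i = lincomb t c by apply: Et.
  have [c c0 sc] := dependent_family lt sp.
  by case/eqP: c0; apply: indep; rewrite sc; case: sN.
case: (pselect (forall e, E e -> exists c, N (e - lincomb s c))) => [sp|].
  by exists k, s.
move=> /existsNP[e /not_implyP[Ee nsp]].
pose s' j := if unlift ord0 j is Some i then s i else e.
have s'E c : lincomb s' c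
    = c 0 ord0 *: e + lincomb s (\row_i c 0 (lift ord0 i)).
  rewrite /lincomb big_ord_recl /s' unlift_none; congr (_ + _).
  by apply: eq_bigr => i _; rewrite liftK mxE.
apply: (IH k.+1 s'); first by rewrite addSnnS.
  by move=> i; rewrite /s'; case: unlift.
move=> c; rewrite s'E => Nc.
have [c0|c0] := eqVneq (c 0 ord0) 0; last first.
  case: nsp; exists (- (c 0 ord0)^-1 *: \row_i c 0 (lift ord0 i)).
  rewrite -[_ *: _]addr0 lincombP lincomb0 addr0 scaleNr opprK.
  by rewrite -[e](scalerK c0) -scalerDr; apply: subspaceZ.
move: Nc; rewrite c0 scale0r add0r => /indep/rowP c1.
apply/rowP => j; case: (unliftP ord0 j) => [i|] ->; last by rewrite c0 mxE.
by have := c1 i; rewrite !mxE.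
Qed.

End Lincomb.

Section UnipotentMatrices.
Variables (F : numClosedFieldType) (n : nat) (S : 'M[F]_n.+1 -> Prop).
Hypotheses (S_mul : forall A B, S A -> S B -> S (A *m B))
  (S_unip : forall A, S A -> exists m, (A - 1) ^+ m = 0).

Let T (t : 'M[F]_n.+1) := forall P : 'M[F]_n.+1 -> Prop,
  subspace P -> (forall A, S A -> P (A - 1)) -> P t.

Let T_sub : subspace T.
Proof.
split=> [P [] //|a u v Tu Tv P sP PS].
by apply: sP.2; [apply: Tu | apply: Tv].
Qed.

Let T_gen A : S A -> T (A - 1).
Proof. by move=> SA P _; apply. Qed.

Let T_mul s t : T s -> T t -> T (s *m t).
Proof.
move=> Ts Tt; apply: (Ts (fun s => T (s *m t))).
  split=> [|a u v Tu Tv]; first by rewrite mul0mx; case: T_sub.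
  by rewrite mulmxDl -scalemxAl; apply: T_sub.2.
move=> A SA; apply: (Tt (fun t => T ((A - 1) *m t))).
  split=> [|a u v Tu Tv]; first by rewrite mulmx0; case: T_sub.
  by rewrite mulmxDr -scalemxAr; apply: T_sub.2.
move=> B SB.
have -> : (A - 1) *m (B - 1) = (A *m B - 1) - (A - 1) - (B - 1).
  rewrite mulmxE mulrBr mulr1 mulrBl mul1r [RHS]addrAC; congr (_ - _).
  by rewrite opprB addrA subrK.
by apply: (subspaceB T_sub); first apply: (subspaceB T_sub); apply: T_gen => //; apply: S_mul.
Qed.

(** Kolchin's theorem.  The span T of the A - 1 is closed under products, since
    (A - 1)(B - 1) = (AB - 1) - (A - 1) - (B - 1), and all its elements have trace 0
    because each A - 1 is nilpotent.  Hence no element of T has eigenvalue 1, and T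
    has a common kernel. *)
Lemma unipotent_matrices_fixed_vector :
  exists2 w : 'rV[F]_n.+1, w != 0 & forall A, S A -> w *m A = w.
Proof.
have T_tr t : T t -> \tr t = 0.
  move=> Tt; apply: (Tt (fun t => \tr t = 0)).
    split=> [|a u v]; rewrite ?mxtrace0 // mxtraceD mxtraceZ => -> ->.
    by rewrite mulr0 addr0.
  by move=> A /S_unip[m]; apply: mxtrace_nilpotent.
have [|w w0 wT] := nil_algebra_common_kernel T_sub T_mul.
  by move=> t v; apply: (traceless_no_fixed_vector T_sub.2 T_mul T_tr).
exists w => // A /T_gen/wT/eqP.
by rewrite mulmxBr mulmx1 subr_eq0 => /eqP.
Qed.

End UnipotentMatrices.

(** Besides unipotence of each element, the orbit of every vector has to lie in
    a finite-dimensional space; this replaces the action being algebraic. *)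
Record locally_unipotent (F : fieldType) (V : lmodType F) (Gam : groupType)
    (act : Gam -> V -> V) : Prop := LocallyUnipotent {
  act_lin : forall g, linear (act g);
  act1 : forall v, act 1%g v = v;
  actM : forall g h v, act (g * h)%g v = act g (act h v);
  act_fin : forall v, exists m (t : 'I_m -> V), forall g, exists c, act g v = lincomb t c;
  act_unip : forall g v, exists m, iter m (fun u => act g u - u) v = 0
}.

(** Kolchin's theorem for the quotient of M by N: the span of the orbit of v is
    finite-dimensional, and the group acts on it modulo N by unipotent matrices. *)
Theorem unipotent_fixed_vector (F : numClosedFieldType) (V : lmodType F)
    (Gam : groupType) (act : Gam -> V -> V) (M N : V -> Prop) v :
  locally_unipotent act -> subspace M -> subspace N ->
  (forall g u, M u -> M (act g u)) -> (forall g u, N u -> N (act g u)) ->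
  M v -> ~ N v ->
  exists w, [/\ M w, ~ N w & forall g, N (act g w - w)].
Proof.
move=> [lin a1 aM fin unip] sM sN stM stN Mv Nv.
have actZ g a u w : act g (a *: u + w) = a *: act g u + act g w by apply: lin.
have actB g u w : act g (u - w) = act g u - act g w.
  by rewrite [u - w]addrC -[- w]scaleN1r actZ scaleN1r addrC.
have act0 g : act g 0 = 0 by rewrite -{1}(subrr 0) actB subrr.
pose E e := forall P : V -> Prop, subspace P -> (forall g, P (act g v)) -> P e.
have sE : subspace E.
  split=> [P [] //|a u w Eu Ew P sP Pv].
  by apply: sP.2; [apply: Eu | apply: Ew].
have Ev : E v by move=> P _ /(_ 1%g); rewrite a1.
have EM e : E e -> M e by apply=> // g; apply: stM.
have stE g e : E e -> E (act g e).
  move=> Ee P sP Pv; apply: (Ee (fun x => P (act g x))).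
    split=> [|a u w Pu Pw]; last by rewrite actZ; apply: sP.2.
    by rewrite act0; case: sP.
  by move=> h; rewrite -aM.
have [m [t tP]] := fin v.
have Et e : E e -> exists c, e = lincomb t c.
  move=> Ee; apply: (Ee (fun e => exists c, e = lincomb t c)) => //.
  split; first by exists 0; rewrite lincomb0.
  by move=> a _ _ [c ->] [d ->]; exists (a *: c + d); rewrite lincombP.
have [[|k] [s [Es indep span]]] := basis_modulo sE sN Et.
  have [c] := span _ Ev; rewrite /lincomb big_ord0 subr0 => /Nv[].
(* Matrices act on rows, so g |-> A reverses products; being the set of all such
   matrices, S is closed under products nevertheless. *)
pose S (A : 'M[F]_k.+1) := exists g,
  forall c, N (act g (lincomb s c) - lincomb s (c *m A)).
have matrix_of g : exists A, forall c, N (act g (lincomb s c) - lincomb s (c *m A)).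
  have /fin_all_exists[f fP] i : exists c, N (act g (s i) - lincomb s c).
    exact: span (stE _ _ (Es i)).
  exists (\matrix_i f i) => c; rewrite lincomb_mul {1}/lincomb.
  have -> : act g (\sum_j c 0 j *: s j) = \sum_j c 0 j *: act g (s j).
    apply: (big_ind2 (fun x y => act g x = y)) => // [x x' y y' <- <-|j _].
      by rewrite -[x]scale1r actZ !scale1r.
    by rewrite -[_ *: _]addr0 actZ act0 addr0.
  rewrite -sumrB; apply: subspace_sum => // j; rewrite rowK -scalerBr.
  exact: subspaceZ.
have S_mul A B : S A -> S B -> S (A *m B).
  move=> [g gA] [h hB]; exists (h * g)%g => c; rewrite aM mulmxA.
  rewrite -(subrK (act h (lincomb s (c *m A))) (act h _)) -addrA -actB.
  by apply: subspaceD => //; apply: stN.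
have S_unip A : S A -> exists m, (A - 1) ^+ m = 0.
  move=> [g gA].
  have it j c : N (iter j (fun u => act g u - u) (lincomb s c)
                   - lincomb s (c *m (A - 1) ^+ j)).
    elim: j => [|j IH] /=; first by rewrite expr0 mulmx1 subrr; case: sN.
    set x := iter _ _ _ in IH *; rewrite exprSr -mulmxE mulmxA mulmxBr mulmx1.
    set d := c *m _ in IH *.
    have -> : act g x - x - lincomb s (d *m A - d)
      = act g (x - lincomb s d) + (act g (lincomb s d) - lincomb s (d *m A))
        - (x - lincomb s d).
      rewrite actB lincombB addrA subrK !opprB [lincomb s d - lincomb s (d *m A)]addrC.
      by rewrite addrACA [- x + _]addrC.
    apply: subspaceB => //.
    by apply: subspaceD => //; apply: stN.
  have /fin_all_exists[f fP] i : exists j, iter j (fun u => act g u - u) (s i) = 0.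
    exact: unip.
  have iter0 j : iter j (fun u => act g u - u) 0 = 0.
    by elim: j => //= j ->; rewrite subr0 act0.
  exists (\max_i f i)%N; apply/row_matrixP => i; rewrite row0; apply: indep.
  have := it (\max_i f i)%N (delta_mx 0 i); rewrite -rowE lincomb_delta.
  rewrite -(subnK (leq_bigmax i)) iterD fP iter0 sub0r -scaleN1r.
  by move=> /(subspaceZ sN (-1)); rewrite scalerA mulrNN mulr1 scale1r.
have [w w0 wS] := unipotent_matrices_fixed_vector S_mul S_unip.
have Ew : E (lincomb s w).
  by apply: (subspace_sum sE) => i; apply: (subspaceZ sE).
exists (lincomb s w); split; first exact: EM.
  by move/indep/eqP; apply/negP.
move=> g; have [A gA] := matrix_of g.
by rewrite -{2}(wS A); [apply: gA | exists g].
Qed.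

(** * Tensors and their values at points *)

Lemma scalar0 (F : fieldType) (U : lmodType F) (f : U -> F) : scalar f -> f 0 = 0.
Proof. by move=> lin; have := lin (-1) 0 0; rewrite scaler0 addr0 mulN1r addNr. Qed.

(** The sum is the trace of the operator w |-> \sum_j f j w *: u j, which is zero.
    In an induction on s, a w with f k w != 0 expresses u k through the other
    u j, and the term of k can be absorbed into the others. *)
Lemma trace_of_zero (F : fieldType) (U : lmodType F) J (s : seq J) (u : J -> U)
    (f : J -> U -> F) :
  (forall j, scalar (f j)) -> (forall w, \sum_(j <- s) f j w *: u j = 0) ->
  \sum_(j <- s) f j (u j) = 0.
Proof.
elim: s f => [|k s IH] f lin op0; first by rewrite big_nil.
case: (pselect (exists w, f k w != 0)) => [[w fw]|nw]; last first.
  have fk0 w : f k w = 0 by apply/eqP/negP => /negP fw; apply: nw; exists w.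
  rewrite big_cons fk0 add0r; apply: IH => // w.
  by have := op0 w; rewrite big_cons fk0 scale0r add0r.
have uk : u k = - \sum_(j <- s) (f j w / f k w) *: u j.
  have := op0 w; rewrite big_cons => /eqP; rewrite addr_eq0 => /eqP e.
  rewrite -[u k](scalerK fw) e scalerN scaler_sumr; congr (- _).
  by apply: eq_bigr => j _; rewrite scalerA mulrC.
have f_sum (c : J -> F) : f k (\sum_(j <- s) c j *: u j) = \sum_(j <- s) c j * f k (u j).
  by elim/big_rec2: _ => [|j x y _ <-]; rewrite ?lin // (scalar0 (lin k)).
rewrite big_cons uk -scaleN1r -[_ *: _]addr0 lin.
rewrite (scalar0 (lin k)) f_sum addr0 mulN1r addrC.
rewrite -[RHS](IH (fun j x => f j x - f j w / f k w * f k x)).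
- by rewrite -sumrB.
- by move=> j a x y; rewrite !lin mulrDr mulrBr opprD addrACA mulrCA.
move=> x; under eq_bigr do rewrite scalerBl.
rewrite sumrB; have -> : \sum_(j <- s) (f j w / f k w * f k x) *: u j
    = f k x *: \sum_(j <- s) (f j w / f k w) *: u j.
  by rewrite scaler_sumr; apply: eq_bigr => j _; rewrite scalerA mulrC.
by have := op0 x; rewrite big_cons uk addrC scalerN.
Qed.

Section Tensors.
Variables (F : fieldType) (A : affine_group F) (J : Type) (s : seq J).
Local Notation O := (coord_alg A).

(** Multilinear sums are tested at points one slot at a time: trace_of_zero
    decouples the linear slot of t' from u, so that u may be evaluated at a point x
    while t' is evaluated at an unrelated a. *)
Lemma weighted_linear_form_eval (c : J -> F) (u : J -> O)
    (t' : J -> O -> F) : (forall j, scalar (t' j)) ->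
  (forall x a, \sum_(j <- s) c j * ev x (u j) * t' j a = 0) ->
  \sum_(j <- s) c j * t' j (u j) = 0.
Proof.
move=> lin t0; apply: (trace_of_zero (f := fun j a => c j * t' j a)) => [j a p q|a].
  by rewrite lin mulrDr mulrCA.
apply: (@ev_sep _ A) => x; rewrite linear0 linear_sum -[RHS](t0 x a).
by apply: eq_bigr => j _; rewrite linearZ /= mulrAC.
Qed.

Lemma linear_form_eval (t : O -> F) (c : J -> F) (u : J -> O) : scalar t ->
  (forall x, \sum_(j <- s) c j * ev x (u j) = 0) -> \sum_(j <- s) c j * t (u j) = 0.
Proof.
move=> lin t0; apply: (weighted_linear_form_eval (t' := fun=> t)) => // x a.
by rewrite -mulr_suml t0 mul0r.
Qed.

Lemma bilinear_form_eval (t : O -> O -> F) (c : J -> F) (u v : J -> O) :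
  (forall b, scalar (t^~ b)) -> (forall a, scalar (t a)) ->
  (forall x y, \sum_(j <- s) c j * (ev x (u j) * ev y (v j)) = 0) ->
  \sum_(j <- s) c j * t (u j) (v j) = 0.
Proof.
move=> lin1 lin2 t0.
apply: (weighted_linear_form_eval (t' := fun j a => t a (v j))) => // x a.
apply: (linear_form_eval (t := t a)) => // y; rewrite -[RHS](t0 x y).
by apply: eq_bigr => j _; rewrite mulrA.
Qed.

Lemma trilinear_form_eval (t : O -> O -> O -> F) (c : J -> F) (u v w : J -> O) :
  (forall b d, scalar (fun a => t a b d)) -> (forall a d, scalar (fun b => t a b d)) ->
  (forall a b, scalar (t a b)) ->
  (forall x y z, \sum_(j <- s) c j * (ev x (u j) * (ev y (v j) * ev z (w j))) = 0) ->
  \sum_(j <- s) c j * t (u j) (v j) (w j) = 0.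
Proof.
move=> lin1 lin2 lin3 t0.
apply: (weighted_linear_form_eval (t' := fun j a => t a (v j) (w j))) => // x a.
apply: (bilinear_form_eval (t := t a)) => // y z; rewrite -[RHS](t0 x y z).
by apply: eq_bigr => j _; rewrite -mulrA.
Qed.

End Tensors.

Section TensorEquality.
Variables (F : fieldType) (A : affine_group F) (J J' : Type) (s : seq J) (s' : seq J').
Variables (c : J -> F) (c' : J' -> F).
Local Notation O := (coord_alg A).

Let sumf T (f : J -> T) (f' : J' -> T) k := match k with inl j => f j | inr j => f' j end.

Let s2 := [seq inl j | j <- s] ++ [seq inr j | j <- s'] : seq (J + J').
Let c2 := sumf c (fun j => - c' j).

Let sum_s2 (f : J + J' -> F) : \sum_(k <- s2) c2 k * f k
  = \sum_(j <- s) c j * f (inl j) - \sum_(j <- s') c' j * f (inr j).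
Proof.
rewrite big_cat !big_map /=; congr (_ + _).
by rewrite -sumrN; apply: eq_bigr => j _; rewrite mulNr.
Qed.

(** In these lemmas two expressions of a tensor with the same values at points are
    compared by concatenating one with the opposite of the other. *)
Lemma linear_form_ext (t : O -> F) (u : J -> O) (u' : J' -> O) : scalar t ->
  (forall x, \sum_(j <- s) c j * ev x (u j) = \sum_(j <- s') c' j * ev x (u' j)) ->
  \sum_(j <- s) c j * t (u j) = \sum_(j <- s') c' j * t (u' j).
Proof.
move=> lin t0; apply/subr0_eq.
have <- := sum_s2 (fun k => t (sumf u u' k)).
by apply: linear_form_eval => // x; rewrite sum_s2 /= t0 subrr.
Qed.

Lemma bilinear_form_ext (t : O -> O -> F) (u v : J -> O) (u' v' : J' -> O) :
  (forall b, scalar (t^~ b)) -> (forall a, scalar (t a)) ->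
  (forall x y, \sum_(j <- s) c j * (ev x (u j) * ev y (v j))
             = \sum_(j <- s') c' j * (ev x (u' j) * ev y (v' j))) ->
  \sum_(j <- s) c j * t (u j) (v j) = \sum_(j <- s') c' j * t (u' j) (v' j).
Proof.
move=> lin1 lin2 t0; apply/subr0_eq.
have <- := sum_s2 (fun k => t (sumf u u' k) (sumf v v' k)).
by apply: bilinear_form_eval => // x y; rewrite sum_s2 /= t0 subrr.
Qed.

Lemma trilinear_form_ext (t : O -> O -> O -> F) (u v w : J -> O) (u' v' w' : J' -> O) :
  (forall b d, scalar (fun a => t a b d)) -> (forall a d, scalar (fun b => t a b d)) ->
  (forall a b, scalar (t a b)) ->
  (forall x y z, \sum_(j <- s) c j * (ev x (u j) * (ev y (v j) * ev z (w j)))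
             = \sum_(j <- s') c' j * (ev x (u' j) * (ev y (v' j) * ev z (w' j)))) ->
  \sum_(j <- s) c j * t (u j) (v j) (w j) = \sum_(j <- s') c' j * t (u' j) (v' j) (w' j).
Proof.
move=> lin1 lin2 lin3 t0; apply/subr0_eq.
have <- := sum_s2 (fun k => t (sumf u u' k) (sumf v v' k) (sumf w w' k)).
by apply: trilinear_form_eval => // x y z; rewrite sum_s2 /= t0 subrr.
Qed.

End TensorEquality.

Section AffineGroupTheory.
Variables (F : fieldType) (G : affine_group F).
Local Notation O := (coord_alg G).

Lemma comul3E (V : nmodType) (f : O -> O -> O -> V) (a : O) :
  \sum_(p <- comul3 a) f p.1.1 p.1.2 p.2
  = \sum_(p <- comul a) \sum_(q <- comul p.2) f p.1 q.1 q.2.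
Proof. by rewrite /comul3 big_allpairs_dep. Qed.

Lemma ev_comul3 (a : O) x y z :
  \sum_(p <- comul3 a) ev x p.1.1 * (ev y p.1.2 * ev z p.2) = ev (x * (y * z))%g a.
Proof.
rewrite (comul3E (fun a b c => ev x a * (ev y b * ev z c))) ev_comul.
by apply: eq_bigr => p _; rewrite -mulr_sumr -ev_comul.
Qed.

Lemma comul3_coassoc (t : O -> O -> O -> F) (a : O) :
  (forall b d, scalar (fun a => t a b d)) -> (forall a d, scalar (fun b => t a b d)) ->
  (forall a b, scalar (t a b)) ->
  \sum_(p <- comul3 a) t p.1.1 p.1.2 p.2
  = \sum_(p <- comul a) \sum_(q <- comul p.1) t q.1 q.2 p.2.
Proof.
move=> lin1 lin2 lin3.
have -> : \sum_(p <- comul a) \sum_(q <- comul p.1) t q.1 q.2 p.2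
    = \sum_(p <- [seq (q.1, q.2, p.2) | p <- comul a, q <- comul p.1]) 1 * t p.1.1 p.1.2 p.2.
  by rewrite big_allpairs_dep; do 2![apply: eq_bigr => ? _]; rewrite mul1r.
under eq_bigr do rewrite -[t _ _ _]mul1r.
apply: trilinear_form_ext => // x y z.
under eq_bigr do rewrite mul1r.
rewrite ev_comul3 big_allpairs_dep mulgA ev_comul; apply: eq_bigr => p _.
by rewrite ev_comul mulr_suml; apply: eq_bigr => q _; rewrite mul1r /= mulrA.
Qed.

Lemma comul_counitr (t : O -> F) a : scalar t ->
  \sum_(p <- comul a) t p.1 * counit p.2 = t a.
Proof.
move=> lin; have -> : t a = \sum_(b <- [:: a]) 1 * t b by rewrite big_seq1 mul1r.
under eq_bigr do rewrite mulrC.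
apply: linear_form_ext => // x; rewrite big_seq1 mul1r -[x in RHS]mulg1 ev_comul.
by apply: eq_bigr => p _; rewrite mulrC.
Qed.

Lemma comul_counitl (t : O -> F) a : scalar t ->
  \sum_(p <- comul a) counit p.1 * t p.2 = t a.
Proof.
move=> lin; have -> : t a = \sum_(b <- [:: a]) 1 * t b by rewrite big_seq1 mul1r.
by apply: linear_form_ext => // x; rewrite big_seq1 mul1r -[x in RHS]mul1g ev_comul.
Qed.

End AffineGroupTheory.

Section Convolution.
Variables (F : fieldType) (G : affine_group F).
Local Notation O := (coord_alg G).

Lemma scalar_cst (d : F) (f : O -> F) : scalar f -> scalar (fun a => d * f a).
Proof. by move=> lf a p q; rewrite lf mulrDr mulrCA. Qed.

Lemma scalar_mulr (d : F) (f : O -> F) : scalar f -> scalar (fun a => f a * d).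
Proof. by move=> lf a p q; rewrite lf mulrDl mulrA. Qed.

Lemma scalar_sum I (r : seq I) (f : I -> O -> F) :
  (forall i, scalar (f i)) -> scalar (fun a => \sum_(i <- r) f i a).
Proof.
move=> lf a p q; rewrite mulr_sumr -big_split.
by apply: eq_bigr => i _; apply: lf.
Qed.

(** In a monoid a left and a right inverse of the same element coincide: both
    sides are the convolution of f, g and h, bracketed in two ways. *)
Lemma convol_unique_inverse (f g h : {biscalar O}) :
  (forall a b, convol f g a b = convol_unit a b) ->
  (forall a b, convol g h a b = convol_unit a b) -> forall a b, f a b = h a b.
Proof.
move=> fg gh a b.
have lin1 (k : {biscalar O}) d : scalar (k^~ d) by move=> ? ? ?; rewrite linearPl.
have lin2 (k : {biscalar O}) d : scalar (k d) by move=> ? ? ?; rewrite linearPr.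
pose t p q := f p.1.1 q.1.1 * (g p.1.2 q.1.2 * h p.2 q.2).
transitivity (\sum_(p <- comul3 a) \sum_(q <- comul3 b) t p q).
  rewrite (comul3E (fun x y z => \sum_(q <- comul3 b) t (x, y, z) q)).
  rewrite -[LHS](comul_counitr a (lin1 f b)); apply: eq_bigr => p _.
  rewrite -[f p.1 b](comul_counitr b (lin2 f p.1)) mulr_suml.
  under [RHS]eq_bigr => p' _ do
    rewrite (comul3E (fun x y z => t (p.1, p'.1, p'.2) (x, y, z))).
  rewrite exchange_big; apply: eq_bigr => q _.
  rewrite -mulrA [counit _ * _]mulrC -/(convol_unit p.2 q.2) -gh /convol mulr_sumr.
  by apply: eq_bigr => p' _; rewrite mulr_sumr.
have r1 p x y : scalar (fun z => t p (z, x, y)).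
  by rewrite /t /=; apply: (scalar_mulr _ (lin2 f _)).
have r2 p x y : scalar (fun z => t p (x, z, y)).
  by rewrite /t /=; apply: (scalar_cst _ (scalar_mulr _ (lin2 g _))).
have r3 p x y : scalar (fun z => t p (x, y, z)).
  by rewrite /t /=; apply: (scalar_cst _ (scalar_cst _ (lin2 h _))).
have l1 q x y : scalar (fun z => t (z, x, y) q).
  by rewrite /t /=; apply: (scalar_mulr _ (lin1 f _)).
have l2 q x y : scalar (fun z => t (x, z, y) q).
  by rewrite /t /=; apply: (scalar_cst _ (scalar_mulr _ (lin1 g _))).
have l3 q x y : scalar (fun z => t (x, y, z) q).
  by rewrite /t /=; apply: (scalar_cst _ (scalar_cst _ (lin1 h _))).
under eq_bigr => p _ do
  rewrite (comul3_coassoc (t := fun x y z => t p (x, y, z)) b (r1 p) (r2 p) (r3 p)).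
rewrite exchange_big /=; under eq_bigr => q _ do rewrite exchange_big /=.
have -> : h a b = \sum_(q <- comul b) \sum_(p <- comul a) convol f g p.1 q.1 * h p.2 q.2.
  rewrite -[LHS](comul_counitl b (lin2 h a)); apply: eq_bigr => q _.
  rewrite -[h a q.2](comul_counitl a (lin1 h q.2)) mulr_sumr; apply: eq_bigr => p _.
  by rewrite fg /convol_unit mulrCA mulrA.
apply: eq_bigr => q _.
transitivity (\sum_(q' <- comul q.1) \sum_(p <- comul a) \sum_(p' <- comul p.1)
    t (p'.1, p'.2, p.2) (q'.1, q'.2, q.2)).
  apply: eq_bigr => q' _.
  rewrite (comul3_coassoc (t := fun x y z => t (x, y, z) (q'.1, q'.2, q.2)) a) //.
rewrite exchange_big /=; apply: eq_bigr => p _; rewrite exchange_big /= mulr_suml.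
apply: eq_bigr => p' _; rewrite mulr_suml; apply: eq_bigr => q' _.
by rewrite /t /= mulrA.
Qed.

End Convolution.

(** * Translations and closed subgroups *)

Section Translations.
Variables (F : fieldType) (G : affine_group F).
Local Notation O := (coord_alg G).

(** The inverse makes this a left action, as for rtrans. *)
Definition ltrans (g : G) (a : O) : O :=
  \sum_(p <- comul a) ev (g^-1)%g p.1 *: p.2.

Lemma ev_rtrans x g (a : O) : ev x (rtrans g a) = ev (x * g)%g a.
Proof.
rewrite /rtrans linear_sum ev_comul; apply: eq_bigr => p _.
by rewrite linearZ /= mulrC.
Qed.

Lemma ev_ltrans x g (a : O) : ev x (ltrans g a) = ev (g^-1 * x)%g a.
Proof.
rewrite /ltrans linear_sum ev_comul; apply: eq_bigr => p _.
by rewrite linearZ.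
Qed.

Lemma rtrans_linear g : linear (@rtrans F G g).
Proof. by move=> c a b; apply: ev_sep => x; rewrite linearP /= !ev_rtrans linearP. Qed.

Lemma ltrans_linear g : linear (ltrans g).
Proof. by move=> c a b; apply: ev_sep => x; rewrite linearP /= !ev_ltrans linearP. Qed.

Lemma rtransM g h (a : O) : rtrans (g * h)%g a = rtrans g (rtrans h a).
Proof. by apply: ev_sep => x; rewrite !ev_rtrans mulgA. Qed.

Lemma ltransM g h (a : O) : ltrans (g * h)%g a = ltrans g (ltrans h a).
Proof. by apply: ev_sep => x; rewrite !ev_ltrans invgM mulgA. Qed.

Lemma rtrans1 (a : O) : rtrans 1%g a = a.
Proof. by apply: ev_sep => x; rewrite ev_rtrans mulg1. Qed.

Lemma ltrans1 (a : O) : ltrans 1%g a = a.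
Proof. by apply: ev_sep => x; rewrite ev_ltrans invg1 mul1g. Qed.

Lemma sum_seq_lincomb (T : Type) (s : seq T) (x : T -> F) (u : T -> O) :
  exists c, \sum_(p <- s) x p *: u p = lincomb (fun i => u (tnth (in_tuple s) i)) c.
Proof.
exists (\row_i x (tnth (in_tuple s) i)); rewrite big_tnth /lincomb.
by apply: eq_bigr => i _; rewrite mxE.
Qed.

Lemma rtrans_locally_unipotent : unipotent G -> locally_unipotent (@rtrans F G).
Proof.
move=> uG; split=> [g|a|g h a|a|//].
- exact: rtrans_linear.
- exact: rtrans1.
- exact: rtransM.
- exists (size (comul a)), (fun i => (tnth (in_tuple (comul a)) i).1) => g.
  exact: (sum_seq_lincomb _ (fun p => ev g p.2) fst).
Qed.

Lemma antipodeK : involutive (@antipode F G).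
Proof. by move=> a; apply: ev_sep => x; rewrite !ev_antipode invgK. Qed.

Lemma antipodeB (a b : O) : antipode (a - b) = antipode a - antipode b.
Proof. by apply: ev_sep => x; rewrite ev_antipode !linearB /= !ev_antipode. Qed.

(** The antipode exchanges left translation by g and right translation by g^-1. *)
Lemma ltrans_locally_unipotent : unipotent G -> locally_unipotent ltrans.
Proof.
move=> uG; split=> [g|a|g h a|a|g a].
- exact: ltrans_linear.
- exact: ltrans1.
- exact: ltransM.
- exists (size (comul a)), (fun i => (tnth (in_tuple (comul a)) i).2) => g.
  exact: (sum_seq_lincomb _ (fun p => ev g^-1%g p.1) snd).
(* ltrans g = antipode o rtrans g o antipode *)
have [n n0] := uG g (antipode a); exists n.
suff -> : iter n (fun u => ltrans g u - u) a
        = antipode (iter n (fun b => rtrans g b - b) (antipode a)).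
  by rewrite n0; apply: ev_sep => x; rewrite ev_antipode !linear0.
elim: n {n0} => [|n IH] /=; first by rewrite antipodeK.
rewrite IH antipodeB; congr (_ - _); apply: ev_sep => x.
by rewrite ev_ltrans !ev_antipode ev_rtrans invgM invgK.
Qed.

End Translations.

Lemma locally_unipotent_pullback (F : fieldType) (V : lmodType F) (A B : groupType)
    (i : A -> B) (act : B -> V -> V) :
  {morph i : x y / (x * y)%g} -> locally_unipotent act ->
  locally_unipotent (fun a => act (i a)).
Proof.
move=> iM [lin a1 aM fin unip].
have i1 : i 1%g = 1%g by apply: (mulgI (i 1%g)); rewrite -iM !mulg1.
split=> [a|v|a b v|v|a v]; first exact: lin.
- by rewrite i1 a1.
- by rewrite iM aM.
- by have [m [t tP]] := fin v; exists m, t => a; apply: tP.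
- exact: unip.
Qed.

Section Embedding.
Variables (F : fieldType) (K G : affine_group F) (i : closed_embedding K G).

Lemma emb1 : i 1%g = 1%g.
Proof. by apply: (mulgI (i 1%g)); rewrite -embM !mulg1. Qed.

Lemma embV k : i k^-1%g = (i k)^-1%g.
Proof. by apply: (mulgI (i k)); rewrite -embM !mulgV emb1. Qed.

(** Evaluation at z factors through restriction to K when z is a zero of all
    functions vanishing on the image, and algebra maps from coord_alg K to F are
    points of K. *)
Lemma emb_closed (z : G) :
  (forall a, (forall k, ev (i k) a = 0) -> ev z a = 0) -> exists k, z = i k.
Proof.
move=> z0.
have ex b := cid (restr_surj i b).
pose f b := ev z (sval (ex b)).
have fE a : f (restr i a) = ev z a.
  rewrite /f; case: (ex _) => a' /= e; apply/eqP; rewrite -subr_eq0 -linearB /=.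
  by apply/eqP/z0 => k; rewrite linearB /= -!ev_restr e subrr.
have fs b : exists a, b = restr i a by have [a <-] := restr_surj i b; exists a.
have flin : linear_for *%R f.
  move=> c a b; have [a' ->] := fs a; have [b' ->] := fs b.
  by rewrite -linearP !fE linearP.
have fmul : monoid_morphism f.
  split=> [|a b]; first by rewrite -(rmorph1 (restr i)) fE rmorph1.
  have [a' ->] := fs a; have [b' ->] := fs b.
  by rewrite -rmorphM !fE rmorphM.
pose f' : {lrmorphism coord_alg K -> F | *%R} :=
  HB.pack f (GRing.isLinear.Build _ _ _ _ f flin) (GRing.isMonoidMorphism.Build _ _ f fmul).
have [k kP] := ev_surj f'.
by exists k; apply: ev_inj => a; rewrite -ev_restr -kP /= fE.
Qed.

Lemma comul_restr (t : coord_alg K -> coord_alg K -> F) a :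
  (forall b, scalar (t^~ b)) -> (forall a, scalar (t a)) ->
  \sum_(p <- comul (restr i a)) t p.1 p.2
  = \sum_(p <- comul a) t (restr i p.1) (restr i p.2).
Proof.
move=> lin1 lin2.
under eq_bigr do rewrite -[t _ _]mul1r.
under [RHS]eq_bigr do rewrite -[t _ _]mul1r.
apply: bilinear_form_ext => // x y.
under eq_bigr do rewrite mul1r.
rewrite -ev_comul ev_restr embM ev_comul.
by apply: eq_bigr => p _; rewrite mul1r !ev_restr.
Qed.

End Embedding.

(** The functions b n : x |-> a(g^-n x g^n) lie in a finite-dimensional space, so
    some combination of them vanishes.  If n is the lowest index in it, evaluating at
    g^(n+1) h g^-(n+1) leaves only the value of a at g h g^-1: the other terms are
    values of a on the image of i, by hypothesis. *)
Lemma conjugate_closed_subgroup (F : fieldType) (K G : affine_group F)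
    (i : closed_embedding K G) (g : G) :
  (forall h, exists k, i h = (g * i k * g^-1)%g) ->
  forall h, exists k, (g * i h * g^-1)%g = i k.
Proof.
move=> sub h; apply: emb_closed => a a0.
have sub' n k : exists k', (g ^- n * i k * g ^+ n)%g = i k'.
  elim: n k => [|n IH] k; first by exists k; rewrite expg0 invg1 mul1g mulg1.
  have [k1 e1] := sub k; have [k2 e2] := IH k1; exists k2.
  by rewrite expgS invgM e1 -e2 !mulgA !mulgVK.
pose b (n : 'I_(size (comul3 a)).+1) := ltrans (g ^+ n)%g (rtrans (g ^+ n)%g a).
have ev_b x n : ev x (b n) = ev (g ^- n * (x * g ^+ n))%g a.
  by rewrite ev_ltrans ev_rtrans mulgA.
pose t j := (tnth (in_tuple (comul3 a)) j).1.2.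
have bt n : exists c, b n = lincomb t c.
  have [c cP] := sum_seq_lincomb (comul3 a)
    (fun p => ev (g ^- n)%g p.1.1 * ev (g ^+ n)%g p.2) (fun p => p.1.2).
  exists c; rewrite -[RHS]cP; apply: ev_sep => x.
  rewrite ev_b -ev_comul3 linear_sum; apply: eq_bigr => p _.
  by rewrite linearZ /= [ev x _ * _]mulrC mulrA.
have [c c0 cb] := dependent_family (ltnSn _) bt.
have [n0 cn0] : exists n, c 0 n != 0.
  apply/existsP; rewrite -negb_forall; apply/negP => /forallP z.
  by case/eqP: c0; apply/rowP => n; rewrite mxE; apply/eqP/z.
case: (@arg_minnP _ n0 (fun n => c 0 n != 0) (@nat_of_ord _) cn0) => n cn nmin {n0 cn0}.
pose x := (g ^+ n.+1 * i h * g ^- n.+1)%g.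
have := congr1 (ev x) cb; rewrite /lincomb linear_sum linear0 (bigD1 n) //=.
rewrite big1 ?addr0 => [|m mn].
  rewrite linearZ /= ev_b => /eqP; rewrite mulf_eq0 (negbTE cn) /= => /eqP <-.
  congr (ev _ a); rewrite /x expgSr invgM.
  by rewrite !mulgA mulVg mul1g mulgVK.
rewrite linearZ /=; have [/eqP ->|cm] := boolP (c 0 m == 0); first by rewrite mul0r.
have lt : (n < m)%N by rewrite ltn_neqAle nmin // andbT eq_sym; apply: contra mn.
rewrite ev_b; have [k kE] := sub' (m - n.+1)%N h.
rewrite -[RHS](mulr0 (c 0 m)) -(a0 k) -kE; congr (_ * ev _ a).
have -> : (g ^+ m = g ^+ n.+1 * g ^+ (m - n.+1))%g by rewrite -expgnDr subnKC.
by rewrite /x invgM !mulgA !mulgVK.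
Qed.

(** * Characters on double cosets and slices *)

Section UnipotentGroup.
Variables (F : numClosedFieldType) (K G : affine_group F).
Variables (i : closed_embedding K G) (uG : unipotent G).

Definition double_coset_point (g z : G) := exists h k, z = (i h * g * i k)%g.

(** Some function vanishes on gH but not on HgH.  A vector fixed by right
    translations among the functions on HgH that vanish on gH is a nonconstant
    function f1 of h in hgk.  A vector fixed by left translations in the space of
    right-invariant functions modulo constants then satisfies the functional
    equation of a character. *)
Lemma character_of_double_coset g :
  ~ (forall h, exists k, i h = (g * i k * g^-1)%g) ->
  exists P : coord_alg G,
    (forall h k z, double_coset_point g z ->
       ev (i h * z * i k)%g P = ev (i h * g)%g P + ev z P)
    /\ exists h, ev (i h * g)%g P != 0.
Proof.
move=> /existsNP[h0 nh0].
have [a [a0 ah0]] : exists a, (forall k, ev (i k) a = 0)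
    /\ ev (g^-1 * i h0 * g)%g a != 0.
  apply: contrapT => na; have [|k kE] := @emb_closed _ _ _ i (g^-1 * i h0 * g)%g.
    by move=> a a0; apply/eqP/negP => /negP ah0; apply: na; exists a.
  by apply: nh0; exists k; rewrite -kE !mulgA mulgV mul1g mulgK.
pose Z := double_coset_point g.
have Zg : Z g by exists 1%g, 1%g; rewrite emb1 mul1g mulg1.
have Zl h z : Z z -> Z (i h * z)%g.
  by move=> [h1 [k ->]]; exists (h * h1)%g, k; rewrite embM !mulgA.
have Zr k z : Z z -> Z (z * i k)%g.
  by move=> [h [k1 ->]]; exists h, (k1 * k)%g; rewrite embM !mulgA.
have Nlin (Q : G -> Prop) : subspace (fun f : coord_alg G => forall z, Q z -> ev z f = 0).
  split=> [z _|c f f' f0 f'0 z Qz]; first by rewrite linear0.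
  by rewrite linearP /= f0 // f'0 // mulr0 addr0.
have right_act := locally_unipotent_pullback (@embM _ _ _ i) (rtrans_locally_unipotent uG).
have left_act := locally_unipotent_pullback (@embM _ _ _ i) (ltrans_locally_unipotent uG).
pose N1 f := forall z, Z z -> ev z f = 0.
pose M1 f := forall z, (exists k, z = (g * i k)%g) -> ev z f = 0.
have [||||f1 [M1f N1f inv1]] :=
    unipotent_fixed_vector (M := M1) (N := N1) (v := ltrans g a) right_act (Nlin _) (Nlin _).
- by move=> k f Mf _ [k1 ->]; rewrite ev_rtrans -mulgA -embM; apply: Mf; exists (k1 * k)%g.
- by move=> k f Nf z Zz; rewrite ev_rtrans; apply/Nf/Zr.
- by move=> _ [k ->]; rewrite ev_ltrans mulgA mulVg mul1g.
- move=> /(_ (i h0 * g)%g (Zl _ _ Zg))/eqP; apply/negP.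
  by rewrite ev_ltrans mulgA.
pose M2 (f : coord_alg G) := forall z, Z z -> forall k, ev (z * i k)%g f = ev z f.
pose N2 (f : coord_alg G) := forall z, Z z -> ev z f = ev g f.
have [|||||| P1 [M2P N2P inv2]] :=
    unipotent_fixed_vector (M := M2) (N := N2) (v := f1) left_act.
- split=> [z _ k|c f f' Mf Mf' z Zz k]; first by rewrite !linear0.
  by rewrite !linearP /= Mf // Mf'.
- split=> [z _|c f f' Nf Nf' z Zz]; first by rewrite !linear0.
  by rewrite !linearP /= Nf // Nf'.
- by move=> h f Mf z Zz k; rewrite !ev_ltrans mulgA -embV Mf //; apply: Zl.
- by move=> h f Nf z Zz; rewrite !ev_ltrans -embV Nf ?(Nf (_ * g)%g) //; apply: Zl.
- move=> z Zz k; apply/eqP; rewrite -subr_eq0 -ev_rtrans -linearB /=.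
  by rewrite inv1.
- move=> N2f; apply: N1f => z Zz; rewrite N2f //.
  by apply: M1f; exists 1%g; rewrite emb1 mulg1.
exists (P1 - ev g P1 *: 1).
have evP z : ev z (P1 - ev g P1 *: 1) = ev z P1 - ev g P1.
  by rewrite linearB linearZ /= rmorph1 mulr1.
split=> [h k z Zz|].
  rewrite !evP M2P; last exact: Zl.
  have := inv2 h^-1%g z Zz; rewrite !linearB /= !ev_ltrans embV invgK => e.
  by rewrite addrA -e subrK.
apply: contrapT => nP; apply: N2P => _ [h [k ->]].
rewrite M2P; last exact: Zl.
by apply/eqP/negP => /negP ne; apply: nP; exists h; rewrite evP subr_eq0.
Qed.

(** The operator L, which applies x to the left translates of b by K, commutes
    with right translation by the whole of G.  Its image is nonzero, hence contains a
    nonzero function fixed by right translations, and such a function is constant. *)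
Lemma translation_slice (x : coord_alg K -> F) c : scalar x -> x c != 0 ->
  exists q : coord_alg G, forall z, x (restr i (rtrans z q)) = 1.
Proof.
move=> xlin xc; have [b0 b0E] := restr_surj i c.
pose L b f := forall z, ev z f = x (restr i (rtrans z b)).
have x0 := scalar0 xlin.
have ex b : exists f, L b f.
  exists (\sum_(p <- comul b) x (restr i p.1) *: p.2) => z.
  rewrite /rtrans !linear_sum /=.
  under [in RHS]eq_bigr do rewrite linearZ /=.
  elim/big_ind2: _ => [//|s u t v -> ->|p _]; first by rewrite -[s]scale1r xlin mul1r scale1r.
  by rewrite linearZ /= -[_ *: restr _ _]addr0 xlin x0 addr0 mulrC.
have rtrans0 z : rtrans z (0 : coord_alg G) = 0.
  by apply: ev_sep => y; rewrite ev_rtrans !linear0.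
have [f0 Lf0] := ex b0.
have [||||||w [[b Lb] w0 winv]] := unipotent_fixed_vector
  (M := fun f => exists b, L b f) (N := fun f => f = 0) (v := f0)
  (rtrans_locally_unipotent uG).
- split=> [|d u v [b Lb] [b' Lb']].
    by exists 0 => z; rewrite rtrans0 !linear0 x0.
  by exists (d *: b + b') => z; rewrite linearP /= Lb Lb' rtrans_linear linearP xlin.
- by split=> // d u v -> ->; rewrite scaler0 addr0.
- move=> g f [b Lb]; exists (rtrans g b) => z.
  by rewrite ev_rtrans Lb rtransM.
- by move=> g f ->; apply: ev_sep => z; rewrite ev_rtrans !linear0.
- by exists b0.
- by move=> f00; case/eqP: xc; rewrite -b0E -[b0]rtrans1 -Lf0 f00 linear0.
have wE z : ev z w = ev 1%g w.
  have /eqP := winv z; rewrite subr_eq0 => /eqP wz.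
  by rewrite -{2}wz ev_rtrans mul1g.
have d0 : ev 1%g w != 0.
  by apply/eqP => w10; apply: w0; apply: ev_sep => z; rewrite wE w10 linear0.
exists ((ev 1%g w)^-1 *: b) => z.
rewrite -[_ *: b]addr0 rtrans_linear linearP rtrans0 linear0 xlin x0 addr0.
by rewrite -Lb wE mulVf.
Qed.
End UnipotentGroup.

(** * The twisted commutator with a character *)

Lemma biscalar_linl (F : fieldType) (U : lmodType F) (f : {biscalar U}) v : scalar (f^~ v).
Proof. by move=> c a b; rewrite linearPl. Qed.

Lemma biscalar_linr (F : fieldType) (U : lmodType F) (f : {biscalar U}) u : scalar (f u).
Proof. by move=> c a b; rewrite linearPr. Qed.

Section TwistedProduct.
Variables (F : fieldType) (K G : affine_group F) (i : closed_embedding K G).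

Lemma counit_restr (a : coord_alg G) : counit (restr i a) = counit a.
Proof. by rewrite /counit ev_restr emb1. Qed.

(** The twisted product for a pair of forms f, h pulled back from K, evaluated at
    z.  Keeping f and h independent lets two_sided_twistC exchange a and b. *)
Definition two_sided_twist (f h : coord_alg K -> coord_alg K -> F)
    (a b : coord_alg G) (z : G) : F :=
  \sum_(p <- comul3 a) \sum_(q <- comul3 b)
    (f (restr i p.1.1) (restr i q.1.1) * h (restr i p.2) (restr i q.2))
    * (ev z p.1.2 * ev z q.1.2).

Lemma two_sided_twistC f h a b z :
  two_sided_twist f h a b z
  = two_sided_twist (fun u v => f v u) (fun u v => h v u) b a z.
Proof.
rewrite /two_sided_twist exchange_big; apply: eq_bigr => q _.
by apply: eq_bigr => p _; rewrite [ev z q.1.2 * _]mulrC.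
Qed.

Lemma sum_comul3_counit (t : coord_alg G -> F) (b : coord_alg G) z : scalar t ->
  \sum_(q <- comul3 b) t q.1.1 * (ev z q.1.2 * counit q.2) = t (rtrans z b).
Proof.
move=> tlin; rewrite (comul3E (fun u v w => t u * (ev z v * counit w))).
have t0 := scalar0 tlin.
rewrite /rtrans; elim/big_rec2: _ => [//|p u v _ ->].
by rewrite tlin -mulr_sumr -ev_comul mulg1 mulrC.
Qed.

(** On K x K the function (u, v) |-> P(u z v) is the tensor
    chi (x) 1 + P(z) 1 (x) 1; the terms with a 1 collapse to counits. *)
Lemma two_sided_twist_character f h (P b : coord_alg G) (chi : coord_alg K) z :
  (forall v, scalar (f^~ v)) -> (forall u, scalar (f u)) ->
  (forall v, scalar (h^~ v)) ->
  (forall v, f 1 v = counit v) -> (forall v, h 1 v = counit v) ->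
  (forall u v, ev (i u * z * i v)%g P = ev u chi + ev z P) ->
  two_sided_twist f h P b z = f chi (restr i (rtrans z b)) + ev z P * ev z b.
Proof.
move=> fl fr hl f1 h1 Pchi.
pose t a := f chi (restr i a) + ev z P * counit a.
have tlin : scalar t.
  move=> c u v; rewrite /t linearP fr /counit linearP /=.
  by rewrite !mulrDr mulrCA addrACA.
have -> : ev z b = counit (rtrans z b) by rewrite /counit ev_rtrans mul1g.
rewrite -/(t _) -(sum_comul3_counit b z tlin) /two_sided_twist exchange_big.
apply: eq_bigr => q _.
pose s u v := f u (restr i q.1.1) * h v (restr i q.2).
transitivity (ev z q.1.2 * \sum_(p <- comul3 P) ev z p.1.2 * s (restr i p.1.1) (restr i p.2)).
  rewrite mulr_sumr; apply: eq_bigr => p _; rewrite -/(s _ _) mulrC.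
  by rewrite [ev z p.1.2 * _ as X in X * _]mulrC mulrA.
have -> : \sum_(p <- comul3 P) ev z p.1.2 * s (restr i p.1.1) (restr i p.2)
    = \sum_(j <- [:: true; false]) (if j then 1 else ev z P) * s (if j then chi else 1) 1.
  apply: (bilinear_form_ext (v' := fun=> 1)) => [v|u|x y].
  - by rewrite /s; apply: (scalar_mulr _ (fl _)).
  - by rewrite /s; apply: (scalar_cst _ (hl _)).
  rewrite big_cons big_seq1 /= !rmorph1 !mulr1 mul1r -(Pchi x y) -mulgA -ev_comul3.
  by apply: eq_bigr => p _; rewrite !ev_restr mulrCA.
rewrite big_cons big_seq1 /s /= f1 !h1 mul1r !counit_restr [RHS]mulrCA.
by congr (_ * _); rewrite /t mulrDl mulrA.
Qed.

End TwistedProduct.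

Section CocycleCharacter.
Variables (F : fieldType) (K : affine_group F) (J : hopf_2cocycle K).
Local Notation O := (coord_alg K).

Lemma counit1 : counit (1 : O) = 1.
Proof. by rewrite /counit rmorph1. Qed.

Lemma cocyc_inv1l b : cocyc_inv J 1 b = counit b.
Proof.
have := convol_cocyc_inv J 1 b; rewrite /convol /convol_unit.
rewrite counit1 mul1r => <-.
rewrite exchange_big /= -[LHS](comul_counitl b (biscalar_linr _ 1)).
apply: eq_bigr => q _.
pose t u v := J u q.1 * cocyc_inv J v q.2.
transitivity (\sum_(j <- [:: tt]) 1 * t 1 1).
  by rewrite big_seq1 mul1r /t cocyc1l.
transitivity (\sum_(p <- comul (1 : O)) 1 * t p.1 p.2); last first.
  by apply: eq_bigr => p _; rewrite mul1r.
apply: (bilinear_form_ext (u := fun=> 1) (v := fun=> 1)) => [v|u|x y].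
- exact: (scalar_mulr _ (biscalar_linl _ _)).
- exact: (scalar_cst _ (biscalar_linl _ _)).
rewrite big_seq1 !rmorph1 !mul1r; under eq_bigr do rewrite mul1r.
by rewrite -ev_comul rmorph1.
Qed.

Lemma cocyc_inv1r a : cocyc_inv J a 1 = counit a.
Proof.
have := convol_cocyc_inv J a 1; rewrite /convol /convol_unit.
rewrite counit1 mulr1 => <-.
rewrite -[LHS](comul_counitl a (biscalar_linl _ 1)).
apply: eq_bigr => p _.
pose t u v := J p.1 u * cocyc_inv J p.2 v.
transitivity (\sum_(j <- [:: tt]) 1 * t 1 1).
  by rewrite big_seq1 mul1r /t cocyc1r.
transitivity (\sum_(q <- comul (1 : O)) 1 * t q.1 q.2); last first.
  by apply: eq_bigr => q _; rewrite mul1r.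
apply: (bilinear_form_ext (u := fun=> 1) (v := fun=> 1)) => [v|u|x y].
- exact: (scalar_mulr _ (biscalar_linr _ _)).
- exact: (scalar_cst _ (biscalar_linr _ _)).
rewrite big_seq1 !rmorph1 !mul1r; under eq_bigr do rewrite mul1r.
by rewrite -ev_comul rmorph1.
Qed.

Variable chi : O.
Hypothesis chiD : forall u v, ev (u * v)%g chi = ev u chi + ev v chi.

(** A character is a primitive element of the coordinate Hopf algebra. *)
Lemma sum_comul_character (t : O -> O -> F) :
  (forall b, scalar (t^~ b)) -> (forall a, scalar (t a)) ->
  \sum_(p <- comul chi) t p.1 p.2 = t chi 1 + t 1 chi.
Proof.
move=> tl tr.
transitivity (\sum_(j <- [:: true; false]) 1 * t (if j then chi else 1) (if j then 1 else chi)).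
  transitivity (\sum_(p <- comul chi) 1 * t p.1 p.2).
    by apply: eq_bigr => p _; rewrite mul1r.
  apply: bilinear_form_ext => // x y.
  rewrite big_cons big_seq1 /= !rmorph1 !mul1r mulr1 -chiD ev_comul.
  by apply: eq_bigr => p _; rewrite mul1r.
by rewrite big_cons big_seq1 !mul1r.
Qed.

(** Evaluate J * J^-1 = counit (x) counit at the primitive element chi. *)
Lemma cocyc_inv_character b : cocyc_inv J chi b = - J chi b.
Proof.
have chi1 : counit chi = 0.
  have := chiD 1%g 1%g; rewrite mulg1 /counit => /eqP.
  by rewrite -subr_eq0 opprD addNKr oppr_eq0 => /eqP.
have := convol_cocyc_inv J chi b; rewrite /convol /convol_unit chi1 mul0r exchange_big /=.
have -> : \sum_(q <- comul b) \sum_(p <- comul chi) J p.1 q.1 * cocyc_inv J p.2 q.2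
    = J chi b + cocyc_inv J chi b.
  rewrite -[J chi b](comul_counitr b (biscalar_linr J chi)).
  rewrite -[cocyc_inv J chi b](comul_counitl b (biscalar_linr _ chi)) -big_split.
  apply: eq_bigr => q _.
  rewrite (sum_comul_character (t := fun u v => J u q.1 * cocyc_inv J v q.2)).
  - by rewrite cocyc_inv1l cocyc1l.
  - by move=> v; apply: (scalar_mulr _ (biscalar_linl _ _)).
  - by move=> u; apply: (scalar_cst _ (biscalar_linl _ _)).
by move/eqP; rewrite addrC addr_eq0 => /eqP.
Qed.

Lemma Rform_character b : Rform J chi b = cocyc_inv J b chi - cocyc_inv J chi b.
Proof.
rewrite cocyc_inv_character opprK /Rform /convol exchange_big /=.
rewrite -[J chi b](comul_counitl b (biscalar_linr J chi)).
rewrite -[cocyc_inv J b chi](comul_counitr b (biscalar_linl _ chi)) -big_split.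
apply: eq_bigr => q _.
rewrite (sum_comul_character (t := fun u v => cocyc_inv J q.1 u * J v q.2)).
- by rewrite cocyc_inv1r cocyc1l.
- by move=> v; apply: (scalar_mulr _ (biscalar_linr _ _)).
- by move=> u; apply: (scalar_cst _ (biscalar_linl _ _)).
Qed.

End CocycleCharacter.

(** Both sides are convolution inverses of J. *)
Lemma cocyc_inv_restr (F : fieldType) (K G : affine_group F) (i : closed_embedding K G)
    (J : hopf_2cocycle G) (JK : hopf_2cocycle K) :
  (forall a b, J a b = JK (restr i a) (restr i b)) ->
  forall a b, cocyc_inv J a b = cocyc_inv JK (restr i a) (restr i b).
Proof.
move=> JE.
pose h0 := fun a b => cocyc_inv JK (restr i a) (restr i b).
have hl v : scalar (h0^~ v) by move=> c a b; rewrite /h0 linearP linearPl.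
have hr u : scalar (h0 u) by move=> c a b; rewrite /h0 linearP linearPr.
pose h : {biscalar coord_alg G} := HB.pack h0
  (bilinear_isBilinear.Build _ _ _ _ _ _ h0 (hl, hr)).
apply: (@convol_unique_inverse _ _ (cocyc_inv J) J h) => a b.
  exact: convol_inv_cocyc.
rewrite /convol; transitivity (convol JK (cocyc_inv JK) (restr i a) (restr i b)).
  rewrite /convol.
  rewrite (comul_restr i (t := fun u v =>
    \sum_(q <- comul (restr i b)) JK u q.1 * cocyc_inv JK v q.2)).
  - apply: eq_bigr => p _.
    rewrite (comul_restr i (t := fun u v =>
      JK (restr i p.1) u * cocyc_inv JK (restr i p.2) v)).
    + by apply: eq_bigr => q _; rewrite JE.
    + by move=> v; apply: (scalar_mulr _ (biscalar_linr _ _)).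
    + by move=> u; apply: (scalar_cst _ (biscalar_linr _ _)).
  - by move=> v; apply: scalar_sum => q; apply: (scalar_mulr _ (biscalar_linl _ _)).
  - by move=> u; apply: scalar_sum => q; apply: (scalar_cst _ (biscalar_linl _ _)).
by rewrite convol_cocyc_inv /convol_unit !counit_restr.
Qed.

(** * Weyl algebras generated by a pair with commutator 1 *)

Section NormalForm.
Variables (F : fieldType) (A : algType F) (p q : A).

(** The outer variable of n stands for p and the inner one for q, with all
    powers of q to the left of those of p. *)
Definition normal_form (n : {poly {poly F}}) : A := (map_poly (horner_alg q) n).[p].

Local Notation nf := normal_form.

Lemma normal_formB n m : nf (n - m) = nf n - nf m.
Proof. by rewrite /nf rmorphB /= hornerD hornerN. Qed.

Lemma normal_formMXaddC n c : nf (n * 'X + c%:P) = nf n * p + horner_alg q c.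
Proof. by rewrite /nf rmorphD rmorphM /= map_polyX map_polyC hornerMXaddC. Qed.

Lemma normal_formC c : nf c%:P = horner_alg q c.
Proof. by rewrite /nf map_polyC hornerC. Qed.

Lemma normal_formMX n : nf (n * 'X) = nf n * p.
Proof. by rewrite /nf rmorphM /= map_polyX hornerMX. Qed.

Lemma normal_form0 : nf 0 = 0.
Proof. by rewrite /nf rmorph0 horner0. Qed.

Lemma normal_formD n m : nf (n + m) = nf n + nf m.
Proof. by rewrite /nf rmorphD /= hornerD. Qed.

Lemma normal_formMC c n : nf (c%:P * n) = horner_alg q c * nf n.
Proof. by rewrite /nf rmorphM /= map_polyC hornerCM. Qed.

Hypothesis pq : p * q - q * p = 1.

Lemma weyl_swap : p * q = q * p + 1.
Proof. by rewrite -pq addrC subrK. Qed.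

Lemma mul_p_horner_alg u : p * horner_alg q u = horner_alg q u * p + horner_alg q u^`().
Proof.
elim/poly_ind: u => [|u c IH]; first by rewrite deriv0 rmorph0 mulr0 mul0r addr0.
rewrite derivMXaddC !rmorphD !rmorphM /= horner_algX horner_algC mulrDr mulrDl mulrA IH.
rewrite mulrDl -!mulrA weyl_swap mulrDr mulr1 -scalerAr -scalerAl mulr1 mul1r.
rewrite -!addrA; congr (_ + _).
by rewrite addrA addrC; congr (_ + _); rewrite addrC.
Qed.

Lemma mul_p_normal_form n : p * nf n = nf (n * 'X + map_poly (@deriv F) n).
Proof.
elim/poly_ind: n => [|n c IH].
  by rewrite mul0r map_poly0 addr0 normal_form0 mulr0.
have -> : map_poly (@deriv F) (n * 'X + c%:P) = map_poly (@deriv F) n * 'X + c^`()%:P.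
  apply/polyP => j; rewrite coef_map_id0 ?deriv0 // !coefD !coefMX !coefC derivD.
  by rewrite coef_map_id0 ?deriv0 //; case: j => [|j] /=; rewrite deriv0.
rewrite normal_formMXaddC mulrDr mulrA IH mul_p_horner_alg.
rewrite !(normal_formD, normal_formMX, normal_formC) !mulrDl.
by rewrite addrACA.
Qed.

Lemma comm_normal_form_q n : nf n * q - q * nf n = nf n^`().
Proof.
have qC u : q * horner_alg q u = horner_alg q u * q.
  by rewrite -{1 4}(horner_algX q) -!rmorphM mulrC.
elim/poly_ind: n => [|n c IH]; first by rewrite deriv0 normal_form0 mul0r mulr0 subrr.
rewrite derivMXaddC normal_formD normal_formMXaddC mulrDl mulrDr qC opprD addrACA subrr addr0.
rewrite normal_formMX.
by rewrite -IH -mulrA weyl_swap mulrDr mulr1 mulrBl !mulrA addrAC addrC.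
Qed.

End NormalForm.

(** The normal form k of the product is found before the algebra is chosen, so
    that the same k serves in all algebras; this is what makes normal forms induce
    algebra morphisms. *)
Lemma normal_form_mul (F : fieldType) n m : exists k : {poly {poly F}},
  forall (A : algType F) (p q : A), p * q - q * p = 1 ->
    normal_form p q n * normal_form p q m = normal_form p q k.
Proof.
elim/poly_ind: n m => [|n c IH] m; first by exists 0 => A p q _; rewrite normal_form0 mul0r.
have [k kP] := IH (m * 'X + map_poly (@deriv F) m).
exists (k + c%:P * m) => A p q pq.
rewrite normal_formMXaddC mulrDl -mulrA (mul_p_normal_form pq) kP //.
by rewrite normal_formD normal_formMC.
Qed.

Lemma deriv_eq0_size1 (R : idomainType) (u : {poly R}) :
  (forall (x : R) k, x *+ k.+1 = 0 -> x = 0) -> u^`() = 0 -> u = (u`_0)%:P.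
Proof.
move=> tf /polyP u0; apply/polyP => -[|k]; rewrite coefC //=.
by apply: (tf _ k); rewrite -coef_deriv u0 coef0.
Qed.

(** Commutators with q and p differentiate a normal form in its outer and inner
    variable; in characteristic 0, repeated differentiation reduces a nonzero normal
    form to a nonzero constant. *)
Lemma normal_form_inj (F : numFieldType) (A : algType F) (p q : A) n :
  p * q - q * p = 1 -> normal_form p q n = 0 -> n = 0.
Proof.
move=> pq.
have tfF (x : F) k : x *+ k.+1 = 0 -> x = 0.
  by move/eqP; rewrite mulrn_eq0 => /eqP.
have tfP (x : {poly F}) k : x *+ k.+1 = 0 -> x = 0.
  by move=> xk; apply/polyP => j; rewrite coef0; apply: (tfF _ k); rewrite -coefMn xk coef0.
have horner0 s (u : {poly F}) : (size u <= s)%N -> horner_alg q u = 0 -> u = 0.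
  elim: s u => [|s IH] u; first by rewrite leqn0 size_poly_eq0 => /eqP.
  move=> us u0; have [//|un0] := eqVneq u 0.
  have du : u^`() = 0.
    apply: IH; first by rewrite -ltnS (leq_trans (lt_size_deriv un0)).
    by have := mul_p_horner_alg pq u; rewrite u0 mulr0 mul0r add0r => <-.
  move: u0; rewrite (deriv_eq0_size1 tfF du) horner_algC => /eqP.
  by rewrite scaler_eq0 oner_eq0 orbF => /eqP ->.
suff main s : (size n <= s)%N -> normal_form p q n = 0 -> n = 0 by apply: (main (size n)).
elim: s n => [|s IH] n; first by rewrite leqn0 size_poly_eq0 => /eqP.
move=> us n0; have [//|nn0] := eqVneq n 0.
have dn : n^`() = 0.
  apply: IH; first by rewrite -ltnS (leq_trans (lt_size_deriv nn0)).
  by rewrite -(comm_normal_form_q pq) n0 mulr0 mul0r subrr.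
move: n0; rewrite (deriv_eq0_size1 tfP dn) normal_formC => /(horner0 _ _ (leqnn _)) ->.
by rewrite polyC0.
Qed.

Section WeylSubalgebra.
Variables (F : fieldType) (A : algType F) (p q : A).

Definition weyl_span : pred A := fun a => `[< exists n, a = normal_form p q n >].

Lemma weyl_spanP a : reflect (exists n, a = normal_form p q n) (a \in weyl_span).
Proof. exact: asboolP. Qed.

Lemma normal_formZ c n : normal_form p q (c%:P%:P * n) = c *: normal_form p q n.
Proof. by rewrite normal_formMC horner_algC -scalerAl mul1r. Qed.

Lemma weyl_span_closed : p * q - q * p = 1 -> GRing.subalg_closed weyl_span.
Proof.
move=> pq; split.
- by apply/weyl_spanP; exists 1%:P; rewrite normal_formC rmorph1.
- move=> c _ _ /weyl_spanP[n ->] /weyl_spanP[m ->]; apply/weyl_spanP.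
  by exists (c%:P%:P * n + m); rewrite normal_formD normal_formZ.
move=> _ _ /weyl_spanP[n ->] /weyl_spanP[m ->]; apply/weyl_spanP.
by have [k kP] := normal_form_mul n m; exists k; apply: kP.
Qed.

Record weyl_subalgebra (pq : p * q - q * p = 1) :=
  WeylSubalgebra { weyl_val : A; weyl_valP : weyl_val \in weyl_span }.

Variable pq : p * q - q * p = 1.
HB.instance Definition _ := [isSub for @weyl_val pq].
HB.instance Definition _ := [Choice of weyl_subalgebra pq by <:].
HB.instance Definition _ := GRing.SubChoice_isSubAlgebra.Build F A weyl_span
  (weyl_subalgebra pq) (GRing.subalg_closed_semi (weyl_span_closed pq)).

Lemma weyl_val_linear : linear (@weyl_val pq : weyl_subalgebra pq -> A).
Proof. by []. Qed.

Lemma weyl_val_monoid_morphism : monoid_morphism (@weyl_val pq : weyl_subalgebra pq -> A).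
Proof. by []. Qed.

HB.instance Definition _ := GRing.isLinear.Build F _ _ _ (@weyl_val pq) weyl_val_linear.
HB.instance Definition _ :=
  GRing.isMonoidMorphism.Build _ _ (@weyl_val pq) weyl_val_monoid_morphism.

End WeylSubalgebra.

Lemma lrmorph_normal_form (F : fieldType) (A B : algType F) (f : {lrmorphism A -> B})
    (p q : A) n : f (normal_form p q n) = normal_form (f p) (f q) n.
Proof.
have f_horner u : f (horner_alg q u) = horner_alg (f q) u.
  elim/poly_ind: u => [|u c IH]; first by rewrite !rmorph0.
  rewrite !rmorphD !rmorphM /= !horner_algX !horner_algC IH.
  by rewrite linearZ /= rmorph1.
elim/poly_ind: n => [|n c IH]; first by rewrite !normal_form0 rmorph0.
by rewrite !normal_formMXaddC rmorphD rmorphM /= IH f_horner.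
Qed.

(** The span of the normal forms in p and q is presented by the Weyl relation:
    normal forms in it are unique and multiply by universal rules, so sending a
    normal form in (p, q) to the same normal form in (p', q') is a morphism. *)
Theorem weyl_pair_contains_weyl (F : numFieldType) (B : algType F) (p q : B) :
  p * q - q * p = 1 -> contains_weyl_subalgebra B.
Proof.
move=> pq; exists 1; split=> //.
pose W : algType F := weyl_subalgebra pq.
have Wp : p \in weyl_span p q.
  apply/weyl_spanP; exists 'X.
  by rewrite -['X]mul1r normal_formMX -[1]polyC1 normal_formC rmorph1 mul1r.
have Wq : q \in weyl_span p q.
  by apply/weyl_spanP; exists ('X%:P); rewrite normal_formC horner_algX.
pose P : W := WeylSubalgebra pq Wp; pose Q : W := WeylSubalgebra pq Wq.
pose v : {lrmorphism W -> B} := @weyl_val _ _ _ _ pq.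
have vI : injective v by exact: val_inj.
have PQ : P * Q - Q * P = 1.
  by apply: vI; rewrite rmorphB !rmorphM rmorph1.
have WE (w : W) : exists n, w = normal_form P Q n.
  have /weyl_spanP[n wn] := weyl_valP w.
  by exists n; apply: vI; rewrite lrmorph_normal_form.
exists W, (fun=> P), (fun=> Q), v; split=> //; split.
- split=> i j; rewrite ?subrr //.
  by rewrite PQ !ord1.
- move=> A p' q' [/(_ ord0 ord0) pq' _ _]; rewrite eqxx in pq'.
  pose f w := normal_form (p' ord0) (q' ord0) (sval (cid (WE w))).
  have fE n : f (normal_form P Q n) = normal_form (p' ord0) (q' ord0) n.
    rewrite /f; case: (cid _) => m /= e; apply/eqP; rewrite -subr_eq0 -normal_formB.
    have -> : m - n = 0 by apply: (normal_form_inj PQ); rewrite normal_formB e subrr.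
    by rewrite normal_form0.
  have flin : linear f.
    move=> c u w; have [n ->] := WE u; have [m ->] := WE w.
    by rewrite -normal_formZ -normal_formD !fE normal_formD normal_formZ.
  have fmul : monoid_morphism f.
    split.
      have -> : (1 : W) = normal_form P Q 1%:P by rewrite normal_formC rmorph1.
      by rewrite fE normal_formC rmorph1.
    move=> u w; have [n ->] := WE u; have [m ->] := WE w.
    by have [k kP] := normal_form_mul n m; rewrite kP // !fE kP.
  pose f' : {lrmorphism W -> A} :=
    HB.pack f (GRing.isLinear.Build _ _ _ _ f flin) (GRing.isMonoidMorphism.Build _ _ f fmul).
  exists f'; split=> i; rewrite (ord1 i).
    have -> : P = normal_form P Q (1 * 'X).
      by rewrite normal_formMX -[1]polyC1 normal_formC rmorph1 mul1r.
    by rewrite /= fE normal_formMX -[1]polyC1 normal_formC rmorph1 mul1r.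
  have -> : Q = normal_form P Q 'X%:P by rewrite normal_formC horner_algX.
  by rewrite /= fE normal_formC horner_algX.
move=> A f f' fp fq w; have [n ->] := WE w.
by rewrite !lrmorph_normal_form (fp ord0) (fq ord0).
Qed.

(** * The twisted function algebra of a double coset *)

Lemma ev_twmul (F : fieldType) (K G : affine_group F) (i : closed_embedding K G)
    (J : hopf_2cocycle G) (JK : hopf_2cocycle K) :
  (forall a b, J a b = JK (restr i a) (restr i b)) ->
  forall a b z, ev z (twmul J a b) = two_sided_twist i (cocyc_inv JK) JK a b z.
Proof.
move=> JE a b z; rewrite /twmul linear_sum; apply: eq_bigr => p _.
rewrite linear_sum; apply: eq_bigr => q _.
by rewrite linearZ /= rmorphM /= JE (cocyc_inv_restr JE).
Qed.

(** The terms P b and b P cancel because the untwisted algebra is commutative. *)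
Lemma commutator_character (F : fieldType) (K G : affine_group F) (i : closed_embedding K G)
    (J : hopf_2cocycle G) (JK : hopf_2cocycle K) (P b : coord_alg G) (chi : coord_alg K) z :
  (forall a b, J a b = JK (restr i a) (restr i b)) ->
  (forall u v, ev (i u * z * i v)%g P = ev u chi + ev z P) ->
  ev z (twmul J P b) - ev z (twmul J b P)
  = cocyc_inv JK chi (restr i (rtrans z b)) - cocyc_inv JK (restr i (rtrans z b)) chi.
Proof.
move=> JE Pchi; rewrite !(ev_twmul JE) [X in _ - X]two_sided_twistC.
rewrite !(two_sided_twist_character (chi := chi) b) //.
- by rewrite opprD addrACA subrr addr0.
all: try by move=> ?; (apply: biscalar_linl || apply: biscalar_linr).
- by move=> v; apply: cocyc_inv1r.
- by move=> v; apply: cocyc1r.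
- by move=> v; apply: cocyc_inv1l.
- by move=> v; apply: cocyc1l.
Qed.

Theorem theorem4p6 (R : realType) (G : affine_group R[i]) (hG : unipotent G)
    (J : hopf_2cocycle G) (H : set G) (hH : is_support J H) (g : G)
    (B : algType R[i]) (pi : {linear coord_alg G -> B})
    (hB : is_twisted_quotient J (vanishing_ideal (double_coset H g)) pi) :
  conjugate_set H g <> H -> contains_weyl_subalgebra B.
Proof.
move=> gH; case: hH => K [i [JK [iH [minJ _] JE]]]; case: hB => _ piI pi1 piM.
have Hi k : H (i k) by rewrite -iH; exists k.
have iHP h : H h -> exists k, h = i k by rewrite -iH => -[k _ <-]; exists k.
have nsub : ~ (forall h, exists k, i h = (g * i k * g^-1)%g).
  move=> sub; apply: gH; apply/seteqP; split=> [_ [h /iHP[k ->] <-]|h /iHP[k ->]].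
    by have [k' ->] := conjugate_closed_subgroup sub k.
  by have [k' ->] := sub k; exists (i k').
have [P [PD [h0 Ph0]]] := character_of_double_coset (i := i) hG nsub.
pose chi := restr i (rtrans g P).
have ev_chi u : ev u chi = ev (i u * g)%g P by rewrite ev_restr ev_rtrans.
have Zg k : double_coset_point i g (i k * g)%g by exists k, 1%g; rewrite emb1 mulg1.
have chiD u v : ev (u * v)%g chi = ev u chi + ev v chi.
  by have := PD u 1%g _ (Zg v); rewrite !ev_chi emb1 mulg1 mulgA embM.
pose x c := cocyc_inv JK chi c - cocyc_inv JK c chi.
have xlin : scalar x.
  by move=> c a b; rewrite /x linearPl linearPr mulrBr opprD addrACA.
have [c xc] : exists c, x c != 0.
  apply: contrapT => nx; have chi0 : chi = 0.
    apply: minJ => b; rewrite (Rform_character _ chiD) -opprB; apply/eqP.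
    by rewrite oppr_eq0; apply/negP => /negP xb; apply: nx; exists b.
  by case/eqP: Ph0; rewrite -ev_chi chi0 linear0.
have [q qx] := translation_slice i hG xlin xc.
apply: (@weyl_pair_contains_weyl _ B (pi P) (pi q)).
rewrite -!piM -pi1 -linearB /=; apply/eqP; rewrite -subr_eq0 -linearB /=; apply/eqP/piI.
move=> z [h [h' [/iHP[k ->] /iHP[k' ->] ->]]].
have Zz : double_coset_point i g (i k * g * i k')%g by exists k, k'.
rewrite !linearB /= rmorph1 (commutator_character (chi := chi) _ JE).
  by rewrite -/(x _) qx subrr.
by move=> u v; rewrite PD // ev_chi.
Qed.
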